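(* Let $m\in\mathbb N$ and $Y>0$ with $m^2Y>1$. For any sequence of positive numbers $\{c_n\}_{n\in\mathbb P_m}$ there exists a sequence $\{y_n\}_{n\in\mathbb P_m}$ with $0<y_n<c_n$ for all $n\in\mathbb P_m$ such that for Lebesgue-almost every $x\in\mathbb R/\mathbb Z$, the measure $\nu_{m,Y}$ is a weak limit of some subsequence of $\{\delta_{n,x,y_n}\}_{n\in\mathbb P_m}$ (i.e. $\nu_{m,Y}$ belongs to the set of limiting measures of this sequence).
   Context: $\mathcal M=\Gamma\backslash\mathbb H$ with $\Gamma=\mathrm{SL}_2(\mathbb Z)$. $\delta_{n,x,y}=\frac1n\sum_{j=0}^{n-1}\delta_{\Gamma(x+j/n+iy)}$. $\mathbb P_m=\{n=m\ell:\ \ell\text{ prime},\ \ell\nmid m\}$. For $Y>0$, $\mu_Y$ is the uniform probability measure on the closed horocycle $\{\Gamma(t+iY):t\in\mathbb R/\mathbb Z\}$, and $\nu_{m,Y}=\frac1m\sum_{d\mid m}\varphi(\tfrac md)\mu_{d^2Y}$, with $\varphi$ Euler's totient. *)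

(* Defs.v *)
From HB Require Import structures.
From mathcomp Require Import all_boot all_order all_algebra.
From mathcomp Require Import all_classical all_reals all_analysis.
Set Implicit Arguments. Unset Strict Implicit. Unset Printing Implicit Defensive.
Import Order.TTheory GRing.Theory Num.Theory.
Import numFieldNormedType.Exports.
Local Open Scope classical_set_scope.
Local Open Scope ring_scope.

Section Modular.
Variable R : realType.

Definition upper_half : set (R * R) := [set p | 0 < p.2].

(* Moebius action of g = [[a, b], [c, d]] : z |-> (a z + b) / (c z + d),
   written in real coordinates. *)
Definition mobius (a b c d : int) (p : R * R) : R * R :=
  let x := p.1 in let y := p.2 in
  let D := (c%:~R * x + d%:~R) ^+ 2 + (c%:~R * y) ^+ 2 in
  (((a%:~R * x + b%:~R) * (c%:~R * x + d%:~R) + a%:~R * c%:~R * y ^+ 2) / D,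
   y / D).

(* f is invariant under Gamma = SL_2(Z) on the upper half plane, i.e. it is
   (the lift of) a function on M = Gamma \ H. *)
Definition SL2Z_invariant (f : R * R -> R) : Prop :=
  forall a b c d : int, a * d - b * c = 1 ->
    forall p, p \in upper_half -> f (mobius a b c d p) = f p.

(* Bounded continuous functions on M = Gamma \ H, viewed as bounded continuous
   Gamma-invariant functions on H (the test functions for weak convergence). *)
Definition test_fun (f : R * R -> R) : Prop :=
  [/\ SL2Z_invariant f,
      {within upper_half, continuous f} &
      exists M : R, forall p, p \in upper_half -> `|f p| <= M].

(* integral of f against delta_{n,x,y} = (1/n) sum_{j<n} delta_{Gamma(x+j/n+iy)} *)
Definition delta_int (n : nat) (x y : R) (f : R * R -> R) : R :=
  n%:R^-1 * \sum_(j < n) f (x + j%:R / n%:R, y).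

(* integral of f against mu_Y, the uniform probability measure on the closed
   horocycle {Gamma(t + iY) : t in R/Z} *)
Definition mu_int (Y : R) (f : R * R -> R) : R :=
  Rintegral lebesgue_measure `[0, 1[ (fun t => f (t, Y)).

Definition nu_int (m : nat) (Y : R) (f : R * R -> R) : R :=
  m%:R^-1 * \sum_(d <- divisors m) (totient (m %/ d))%:R * mu_int ((d ^ 2)%:R * Y) f.

Definition weak_cvg_delta_nu (nk : nat -> nat) (x : R) (y : nat -> R)
    (m : nat) (Y : R) : Prop :=
  forall f, test_fun f ->
    (fun k => delta_int (nk k) x (y (nk k)) f) @ \oo --> nu_int m Y f.

End Modular.

Definition inPm (m n : nat) : Prop :=
  exists l : nat, [/\ prime l, ~~ (l %| m)%N & n = (m * l)%N].

(* Main.v *)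
Require Import Defs.
From HB Require Import structures.
From mathcomp Require Import all_boot all_order all_algebra.
From mathcomp Require Import zify ring lra.
Import Order.TTheory GRing.Theory Num.Theory.
Local Open Scope ring_scope.

(** Let [n = m l] and let [x] be extremely close to a reduced fraction [p / q]
with [q = m l r], [r] prime to [n].  Then [x + j / n] is close to
[(p + j r) / q], whose denominator is [q / d] with [d = gcd (p + j r, n)], so if
[q ^ 2 y] is close to [1 / Y] the point [x + j / n + i y] is Gamma-equivalent to a
point at height close to [d ^ 2 Y].  For fixed [j mod m] the corresponding [l]
points are, up to the single class where [l] divides [p + j r], equally spaced
with step [1 / l], and a proportion [phi (m / d) / m] of the classes has gcd [d]
with [m]: as [l] grows the sample measure tends to [nu_{m, Y}].

For given relative precision [1 / e] and [y] small, the set of such [x] has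
density at least a constant times [1 / l] in every interval.  Since the sum of
[1 / l] over the primes diverges and [y_n] may be chosen so small that this
density holds inside the set left over by the previous stages, almost every [x]
is caught for infinitely many [l], for every [e]. *)

(** * Counting coprime pairs and primes *)

(** The density of the balls does not depend on how small the height is. With [K = 2 m B], and up to
    constants depending on [m], there are about [K / e] admissible [r], each with about [n K]
    numerators, and every ball has radius [1 / (e Y (n K) ^ 2)]. The powers of [K] cancel and the
    total measure is of order [1 / (e ^ 2 Y n)]. Hence [B] can be taken as large as the bound
    [y_n < c_n] and the spreading of the balls over the leftover open set require. One height per
    prime has to serve all precisions. At stage [l] only the precisions [1 / (k + 1)] with [k < l]
    are treated, which is a finite list of conditions on [B], and each fixed [k] still meets all
    large primes. Being caught is a property of [x] alone, expressed by coprimality and distance. A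
    test function only decides from which precision on its integrals are close, so one null set
    serves all test functions. *)

Lemma card_dvd_progression (N d c D : nat) : (0 < d)%N -> coprime d D ->
  (#|[set i : 'I_N | (d %| c + D * i)%N]| <= (N %/ d).+1)%N.
Proof.
move=> d0 cdD.
(* Each block of [d] consecutive indices contains at most one solution, [D] being invertible modulo
   [d]; [g] is the block number. *)
pose g (i : 'I_N) : 'I_(N %/ d).+1 := inord (i %/ d).
have gE i : g i = (i %/ d)%N :> nat.
  by rewrite /g inordK // ltnS leq_div2r // ltnW.
rewrite -[leqRHS]card_ord -(@card_in_imset _ _ g) ?max_card //.
have wlogP (i j : 'I_N) : (i <= j)%N -> (d %| c + D * i)%N ->
    (d %| c + D * j)%N -> (i %/ d = j %/ d)%N -> i = j.
  move=> ij di dj q.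
  have : (d %| (c + D * j) - (c + D * i))%N by rewrite dvdn_sub.
  rewrite subnDl -mulnBr Gauss_dvdr // => /dvdnP [k Ek].
  apply: val_inj => /=.
  rewrite (divn_eq i d) (divn_eq j d) in Ek ij *.
  have := ltn_pmod i d0; have := ltn_pmod j d0.
  rewrite q in Ek *; move: Ek; rewrite subnDl.
  case: k => [|k]; nia.
move=> i j; rewrite !inE => di dj /(congr1 val) /=; rewrite -/(g i) -/(g j) => q.
have {}q : (i %/ d = j %/ d)%N by rewrite -!gE; exact: q.
case: (leqP i j) => [ij|/ltnW ji]; first exact: wlogP.
by apply/esym/wlogP.
Qed.

(** Since [r] is invertible modulo [m], [j -> p + j r] permutes the residues, and [totient (m %/ d)]
    residues have gcd [d] with [m]. The weights of [nu_int] come from here. *)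
Lemma sum_gcd_progression (V : nmodType) (G : nat -> V) (m p r : nat) :
  (0 < m)%N -> coprime r m ->
  \sum_(j < m) G (gcdn (p + j * r) m) =
  \sum_(d <- divisors m) G d *+ totient (m %/ d).
Proof.
move=> m0 crm.
have lt_m k : (k %% m < m)%N by rewrite ltn_pmod.
pose h (j : 'I_m) : 'I_m := Ordinal (lt_m (p + j * r)%N).
have h_inj : injective h.
  have W (i j : 'I_m) : (i <= j)%N -> h i = h j -> i = j.
    move=> ij /(congr1 val) /= E; apply: val_inj => /=.
    have : (m %| (p + j * r) - (p + i * r))%N.
      by rewrite -eqn_mod_dvd ?leq_add2l ?leq_mul2r ?ij ?orbT // E.
    rewrite subnDl -mulnBl Gauss_dvdl 1?coprime_sym // => /dvdnP [k Ek].
    have := ltn_ord j; case: k Ek => [|k]; nia.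
  move=> i j; case: (leqP i j) => [ij|/ltnW ji] E; first exact: W.
  by apply/esym/W.
rewrite (eq_bigr (fun j => G (gcdn (h j) m))); last by move=> j _; rewrite /= gcdn_modl.
rewrite -(reindex_inj h_inj (P := xpredT) (F := fun j : 'I_m => G (gcdn j m))) /=.
have part (j : 'I_m) :
    G (gcdn j m) = \sum_(d <- divisors m | d == gcdn j m) G d.
  have gj : gcdn j m \in divisors m by rewrite -dvdn_divisors // dvdn_gcdr.
  rewrite big_mkcond (bigD1_seq _ gj (divisors_uniq m)) /= eqxx.
  by rewrite big1 ?addr0 // => d /negPf ->.
rewrite (eq_bigr _ (fun j _ => part j)) (exchange_big_dep predT) //=.
rewrite big_seq [RHS]big_seq; apply: eq_bigr => d.
rewrite -dvdn_divisors // => dm.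
have d0 : (0 < d)%N by apply: dvdn_gt0 dm.
rewrite sumr_const; congr (_ *+ _).
have md0 : (0 < m %/ d)%N by rewrite divn_gt0 // dvdn_leq.
rewrite totient_count_coprime big_mkord -sum1_card.
rewrite -(big_mkcond (fun i : 'I_(m %/ d) => coprime (m %/ d) i) (fun=> 1%N)) /=.
rewrite !sum1_card.
have mE : m = (m %/ d * d)%N by rewrite divnK.
have lt_md (i : 'I_(m %/ d)) : (i * d < m)%N by rewrite {2}mE ltn_pmul2r.
pose k (i : 'I_(m %/ d)) : 'I_m := Ordinal (lt_md i).
have k_inj : injective k.
  move=> i j /(congr1 val) /= /eqP; rewrite eqn_pmul2r // => /eqP E.
  exact: val_inj.
rewrite -(card_imset _ k_inj); apply: eq_card => j.
rewrite unfold_in /=; apply/idP/imsetP.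
  move=> /eqP /esym E.
  have dj : (d %| j)%N by rewrite -E dvdn_gcdl.
  have ltj : (j %/ d < m %/ d)%N by rewrite ltn_divLR // divnK.
  exists (Ordinal ltj); last by apply: val_inj; rewrite /= divnK.
  rewrite unfold_in /= /coprime.
  have : (gcdn (m %/ d * d) (j %/ d * d) = d)%N by rewrite !divnK // gcdnC.
  by rewrite -muln_gcdl => /eqP; rewrite -[X in _ == X]mul1n eqn_pmul2r.
move=> [i]; rewrite unfold_in /= => ci ->.
have gi : gcdn (i * d) m = d.
  by rewrite [X in gcdn _ X]mE -muln_gcdl gcdnC (eqP ci) mul1n.
by rewrite /= gi; apply/eqP.
Qed.

Lemma exists_pow_lt_pow2 (N : nat) : exists a, (0 < a)%N /\ (4 * a ^ N <= 2 ^ a)%N.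
Proof.
(* With [s = 2 N + 4] and [a = 2 ^ s] the claim reads [2 + s N <= 2 ^ s]. *)
exists (2 ^ (N + N.+4))%N; split; first by rewrite expn_gt0.
rewrite -expnM (_ : 4 = 2 ^ 2)%N // -expnD leq_exp2l // expnD.
have h1 : (N < 2 ^ N)%N by apply: ltn_expl.
have -> : (2 ^ N.+4 = 16 * 2 ^ N)%N by rewrite !expnS; lia.
nia.
Qed.

(* Euclid-Erdos counting: fewer than half of the integers below [2 ^ a] have all
   their prime factors below [N], since their exponents are all below [a]. *)
Lemma sum_inv_primes_ge (R : realFieldType) (N : nat) :
  exists N', 4^-1 <= \sum_(N <= p < N' | prime p) (p%:R^-1 : R).
Proof.
have [a [a0 ha]] := exists_pow_lt_pow2 N.
pose X := (2 ^ a)%N; exists X.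
have X0 : (0 < X)%N by rewrite expn_gt0.
pose S1 := [set i : 'I_X | (0 < i)%N && all (fun p => p < N)%N (primes i)].
pose S2 p := [set i : 'I_X | (0 < i)%N && (p %| i)%N].
have S1X : (#|S1| <= a ^ N)%N.
  (* The vector of exponents of [i]. For [i > 0] the default of [insubd] is never reached, as
     [2 ^ logn p i <= i < 2 ^ a]. *)
  pose e (i : 'I_X) : {ffun 'I_N -> 'I_a} := [ffun p : 'I_N => insubd (Ordinal a0) (logn p i)].
  have eE (i : 'I_X) (p : 'I_N) : (0 < i)%N -> e i p = logn p i :> nat.
    move=> i0; rewrite ffunE val_insubd ifT //.
    case pp: (prime p); last by rewrite lognE pp.
    rewrite -(ltn_exp2l _ _ (isT : 1 < 2)%N); apply: leq_ltn_trans (ltn_ord i).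
    apply: leq_trans (dvdn_leq i0 (pfactor_dvdnn p i)).
    by case: (logn p i) => // k; rewrite leq_exp2r ?prime_gt1.
  have -> : (a ^ N = #|{ffun 'I_N -> 'I_a}|)%N by rewrite card_ffun !card_ord.
  rewrite -(@card_in_imset _ _ e) ?max_card // => i j.
  rewrite !inE => /andP [i0 iN] /andP [j0 jN] eij; apply: val_inj.
  apply: eqn_from_log => // p.
  case: (ltnP p N) => pN; last first.
    have z (k : nat) : all (fun p => p < N)%N (primes k) -> logn p k = 0%N.
      move=> /allP h; apply/eqP; rewrite -leqn0 leqNgt logn_gt0.
      by apply: contraL pN => /h; rewrite -ltnNge.
    by rewrite !z.
  have := congr1 (fun f : {ffun 'I_N -> 'I_a} => val (f (Ordinal pN))) eij.
  by rewrite /= !eE.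
have S2X p : prime p -> (#|S2 p|%:R <= X%:R / p%:R :> R).
  move=> pp; have p0 := prime_gt0 pp.
  rewrite ler_pdivlMr ?ltr0n // -natrM ler_nat.
  apply: leq_trans (leq_trunc_div X p); rewrite leq_mul2r; apply/orP; right.
  have := @card_dvd_progression X p 0 1 p0 (coprimen1 p).
  rewrite (cardsD1 (Ordinal X0)) inE /= muln0 addn0 dvdn0 ltnS; apply: leq_trans.
  apply: subset_leq_card; apply/subsetP => i; rewrite !inE add0n mul1n -val_eqE /=.
  by rewrite lt0n.
have cov : ([set i : 'I_X | 0 < i] \subset
    S1 :|: \bigcup_(p < X | prime p && (N <= p)) S2 p)%N.
  apply/subsetP => i; rewrite !inE => i0; rewrite i0 /=.
  case: allP => //= h.
  have [p pi pN] : exists2 p, p \in primes i & (N <= p)%N.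
    by apply/hasP; apply: contra_notT h => /hasPn h' p /h'; rewrite -ltnNge.
  have := pi; rewrite mem_primes => /and3P [pp _ pdi].
  have pX : (p < X)%N by apply: leq_ltn_trans (ltn_ord i); apply: dvdn_leq.
  by apply/bigcupP; exists (Ordinal pX); rewrite ?pp // inE i0.
have cX : (#|[set i : 'I_X | 0 < i]| = X.-1)%N.
  have -> : [set i : 'I_X | (0 < i)%N] = [set~ Ordinal X0].
    by apply/setP => i; rewrite !inE -val_eqE /= lt0n.
  by rewrite cardsC1 card_ord.
have : (X.-1%:R <= (a ^ N)%:R + X%:R * \sum_(N <= p < X | prime p) (p%:R^-1 : R)).
  rewrite -cX.
  apply: le_trans (_ : (#|S1| + #|\bigcup_(p < X | prime p && (N <= p)%N) S2 p|)%:R <= _).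
    rewrite ler_nat; apply: leq_trans (subset_leq_card cov) _; exact: leq_card_setU.
  rewrite natrD lerD ?ler_nat //.
  apply: le_trans (_ : (\sum_(p < X | prime p && (N <= p)%N) #|S2 p|)%:R <= _).
    rewrite ler_nat; apply: (big_ind2 (fun (A : {set 'I_X}) n => #|A| <= n)%N) => //.
      by rewrite cards0.
    move=> A n B k An Bk; apply: leq_trans (leq_card_setU A B) _; exact: leq_add.
  rewrite natr_sum mulr_sumr big_geq_mkord /=.
  under [leRHS]eq_bigl do rewrite andbC.
  rewrite [leRHS](eq_bigl (fun p : 'I_X => prime p && (N <= p)%N)).
    by apply: ler_sum => p /andP [pp _]; exact: S2X.
  by move=> p; rewrite andbC.
have : (4%:R * (a ^ N)%:R <= X%:R :> R) by rewrite -natrM ler_nat.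
have : (1 <= (a ^ N)%:R :> R) by rewrite ler1n expn_gt0 a0.
rewrite -subn1 natrB //.
have : (0 < X%:R :> R) by rewrite ltr0n.
set S := \sum_(_ <= _ < _ | _) _; set b := (a ^ N)%:R; set x : R := X%:R.
move=> x0 b1 bx h; rewrite -(ler_pM2l x0); lra.
Qed.

Lemma sum_inv_primes_diverges (R : archiRealFieldType) (C : R) (N : nat) :
  exists N', (N <= N')%N /\ C <= \sum_(N <= p < N' | prime p) (p%:R^-1 : R).
Proof.
have step (k : nat) : exists N', (N <= N')%N /\
    k%:R / 4 <= \sum_(N <= p < N' | prime p) (p%:R^-1 : R).
  elim: k => [|k [M [NM hM]]].
    by exists N; rewrite leqnn mul0r big_geq.
  have [M' hM'] := @sum_inv_primes_ge R M.
  have MM' : (M <= M')%N.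
    by rewrite leqNgt; apply/negP => /ltnW le; move: hM'; rewrite big_geq //; lra.
  exists M'; split; first exact: leq_trans NM MM'.
  by rewrite (big_cat_nat NM MM') /= -natr1; lra.
have [N' [NN' h]] := step (Num.bound `|4 * C|).
exists N'; split=> //; apply: le_trans h.
by have := ltW (archi_boundP (normr_ge0 (4 * C))); have := ler_norm (4 * C); lra.
Qed.

Lemma card_pairs_le (A P : finType) (Q : pred A) (W : A -> pred P) (x y : nat) :
  (#|[set a | Q a]| <= x)%N ->
  (forall a, Q a -> #|[set b | W a b]| <= y)%N ->
  (#|[set ab : A * P | Q ab.1 && W ab.1 ab.2]| <= x * y)%N.
Proof.
move=> hx hy; rewrite -sum1_card.
rewrite (eq_bigl (fun ab : A * P => Q ab.1 && W ab.1 ab.2)); last by move=> ab; rewrite inE.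
rewrite -(pair_big_dep Q W (fun _ _ => 1%N)) /=.
apply: leq_trans (_ : \sum_(a | Q a) y <= _)%N.
  by apply: leq_sum => a Qa; rewrite sum1_card -(cardsE (W a)) hy.
by rewrite sum_nat_const -cardsE leq_mul2r hx orbT.
Qed.

(** Telescoping: [(2 i + 1) ^ 2 >= 4 i (i + 1)]. The value [1 / 4] is the proportion of pairs lost
    to common odd divisors, hence the [3 / 4] in the count of coprime pairs. *)
Lemma sum_inv_odd_sqr_le (R : realFieldType) (S : nat) :
  \sum_(1 <= i < S.+1) ((2 * i + 1)%:R ^- 2 : R) <= 4^-1.
Proof.
suff: \sum_(1 <= i < S.+1) ((2 * i + 1)%:R ^- 2 : R) <= 4^-1 * (1 - S.+1%:R^-1).
  move=> h; apply: le_trans h _; have : 0 <= (S.+1%:R^-1 : R) by rewrite invr_ge0.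
  by move: (S.+1%:R^-1 : R) => x x0; lra.
elim: S => [|S IH]; first by rewrite big_geq // invr1 subrr mulr0.
rewrite big_nat_recr //=; apply: le_trans (lerD IH (lexx _)) _.
rewrite -lerBrDl natrD natrM -(natr1 S.+1) -(natr1 S).
have s0 : 0 <= (S%:R : R) by exact: ler0n.
set s : R := S%:R in s0 *.
rewrite (_ : _ - _ = ((4 * (s + 1) * (s + 1 + 1))^-1)).
  by rewrite lef_pV2 ?posrE; nra.
by field; apply/andP; split; lra.
Qed.

(* Indices of the pairs [r = 1 + 2 m (B + a)], [p = 1 + 2 m (c a + b)] such that
   [p / (m l r)] is reduced and [r] is prime to [m l]; the residues modulo [2 m]
   leave only [l] and odd primes to be excluded. *)
Definition coprime_pairs (m l B A P : nat) (c : nat -> nat) : {set 'I_A * 'I_P} :=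
  [set ab : 'I_A * 'I_P | ~~ (l %| 1 + 2 * m * (B + ab.1))%N &&
    coprime (1 + 2 * m * (c ab.1 + ab.2)) (m * l * (1 + 2 * m * (B + ab.1)))].

(* Non-coprime pairs are counted by a common odd divisor [2 i + 1]; the linear
   remainder terms are controlled by [1 / s <= 1 / t + t / s ^ 2]. *)
Lemma card_coprime_pairs_ge (R : realFieldType) (m l B A P t : nat) (c : nat -> nat) :
  prime l -> coprime l (2 * m) -> (A <= B)%N -> (0 < t)%N ->
  A%:R * P%:R * (3 / 4 - 2 / l%:R)
    - (A%:R + P%:R) * (1 + t%:R + (2 * m * B)%:R / t%:R) - (2 * m * B)%:R
  <= #|coprime_pairs m l B A P c|%:R :> R.
Proof.
move=> pl cl AB t0.
pose r a := (1 + 2 * m * (B + a))%N.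
pose p a b := (1 + 2 * m * (c a + b))%N.
(* As [a < A <= B], one has [r a <= 1 + 2 S], so every divisor [2 i + 1] of [r a] has [i <= S]. *)
set S := (2 * m * B)%N; rewrite -/S /coprime_pairs.
set G := [set _ | _]; have l0 := prime_gt0 pl.
pose B1 := [set ab : 'I_A * 'I_P | (l %| r ab.1)%N && true].
pose B2 := [set ab : 'I_A * 'I_P | true && (l %| p ab.1 ab.2)%N].
pose B3 i := [set ab : 'I_A * 'I_P | (2 * i + 1 %| r ab.1)%N && (2 * i + 1 %| p ab.1 ab.2)%N].
have cov : [set: 'I_A * 'I_P] \subset
    G :|: (B1 :|: (B2 :|: \bigcup_(i < S.+1 | (1 <= i)%N) B3 i)).
  apply/subsetP => ab _; rewrite !inE /=.
  case: (boolP (l %| r ab.1)%N) => //= lr; rewrite ?orbT //.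
  case: (boolP (l %| p ab.1 ab.2)%N) => //= lp; rewrite ?orbT //.
  rewrite !coprimeMr.
  have -> : coprime (p ab.1 ab.2) m.
    rewrite /p /coprime; apply/eqP.
    have -> : (1 + 2 * m * (c ab.1 + ab.2) = 2 * (c ab.1 + ab.2) * m + 1)%N by lia.
    by rewrite gcdnC gcdnMDl gcdn1.
  have -> : coprime (p ab.1 ab.2) l by rewrite coprime_sym prime_coprime.
  rewrite /= /coprime; case: (eqVneq (gcdn (p ab.1 ab.2) (r ab.1)) 1%N) => //= g1.
  set g := gcdn _ _ in g1.
  have gp : (g %| p ab.1 ab.2)%N by apply: dvdn_gcdl.
  have gr : (g %| r ab.1)%N by apply: dvdn_gcdr.
  have og : odd g by apply: dvdn_odd gr _; rewrite /r oddD -mulnA oddM.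
  have gE : g = (2 * g./2 + 1)%N by have := odd_double_half g; rewrite og; lia.
  have gle : (g <= r ab.1)%N by apply: dvdn_leq gr.
  have aA := ltn_ord ab.1.
  have gS : (g./2 < S.+1)%N by rewrite /S; move: gle; rewrite /r; nia.
  by apply/bigcupP; exists (Ordinal gS); rewrite ?inE /= -?gE ?gp ?gr //; lia.
have c1 : (#|B1| <= (A %/ l).+1 * P)%N.
  apply: (@card_pairs_le 'I_A 'I_P (fun a => l %| r a)%N (fun _ _ => true)).
    have := @card_dvd_progression A l (1 + 2 * m * B) (2 * m) l0 cl.
    by congr (_ <= _)%N; apply: eq_card => a; rewrite !inE /r mulnDr addnA.
  by move=> a _; rewrite -[leqRHS]card_ord max_card.
have c2 : (#|B2| <= A * (P %/ l).+1)%N.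
  apply: (@card_pairs_le 'I_A 'I_P (fun=> true) (fun a b => l %| p a b)%N).
    by rewrite -[leqRHS]card_ord max_card.
  move=> a _; have := @card_dvd_progression P l (1 + 2 * m * c a) (2 * m) l0 cl.
  by congr (_ <= _)%N; apply: eq_card => b; rewrite !inE /p mulnDr addnA.
have c3 i : (#|B3 i| <= (A %/ (2 * i + 1)).+1 * (P %/ (2 * i + 1)).+1)%N.
  set s := (2 * i + 1)%N; have s0 : (0 < s)%N by rewrite /s addn1.
  case: (boolP (coprime s (2 * m))) => cs; last first.
    rewrite (_ : B3 i = finset.set0) ?cards0 //; apply/setP => ab; rewrite !inE.
    apply/negP => /andP [sr _]; move/negP: cs; apply.
    have : coprime (r ab.1) (2 * m).
      rewrite coprime_sym /coprime.
      have -> : r ab.1 = ((B + ab.1) * (2 * m) + 1)%N by rewrite /r; lia.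
      by rewrite gcdnMDl gcdn1.
    by apply: coprime_dvdl.
  apply: (@card_pairs_le 'I_A 'I_P (fun a => s %| r a)%N (fun a b => s %| p a b)%N).
    have := @card_dvd_progression A s (1 + 2 * m * B) (2 * m) s0 cs.
    by congr (_ <= _)%N; apply: eq_card => a; rewrite !inE /r mulnDr addnA.
  move=> a _; have := @card_dvd_progression P s (1 + 2 * m * c a) (2 * m) s0 cs.
  by congr (_ <= _)%N; apply: eq_card => b; rewrite !inE /p mulnDr addnA.
have divle (X s : nat) : (0 < s)%N -> (X %/ s).+1%:R <= X%:R / s%:R + 1 :> R.
  move=> s0; rewrite -natr1 lerD2r ler_pdivlMr ?ltr0n // -natrM ler_nat.
  exact: leq_trunc_div.
have c3R : (#|\bigcup_(i < S.+1 | (1 <= i)%N) B3 i|%:R : R) <=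
    A%:R * P%:R / 4 + (A%:R + P%:R) * (S%:R / t%:R + t%:R / 4) + S%:R.
  apply: le_trans (_ : (\sum_(1 <= i < S.+1) #|B3 i|)%:R <= _).
    rewrite ler_nat big_geq_mkord /=.
    apply: (big_ind2 (fun (X : {set 'I_A * 'I_P}) n => #|X| <= n)%N) => //.
      by rewrite cards0.
    move=> X n Z k Xn Zk; apply: leq_trans (leq_card_setU X Z) _; exact: leq_add.
  rewrite natr_sum.
  apply: le_trans (_ : \sum_(1 <= i < S.+1) ((A%:R * P%:R + (A%:R + P%:R) * t%:R)
      * ((2 * i + 1)%:R ^- 2) + ((A%:R + P%:R) / t%:R + 1)) <= _).
    rewrite big_nat [leRHS]big_nat; apply: ler_sum => i _.
    have s0 : (0 < 2 * i + 1)%N by rewrite addn1.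
    apply: le_trans (_ : ((A %/ (2 * i + 1)).+1 * (P %/ (2 * i + 1)).+1)%:R <= _).
      by rewrite ler_nat.
    rewrite natrM; apply: le_trans (ler_pM _ _ (divle A _ s0) (divle P _ s0)) _ => //.
    have {s0}: 0 < (2 * i + 1)%:R :> R by rewrite ltr0n.
    have : 0 < t%:R :> R by rewrite ltr0n.
    have : 0 <= A%:R + P%:R :> R by rewrite addr_ge0.
    set s : R := (_ + 1)%:R; move: (A%:R : R) (P%:R : R) (t%:R : R) => a q v u0 v0 s0.
    have key : s^-1 <= v * s ^- 2 + v^-1.
      have -> : v * s ^- 2 + v^-1 = s^-1 + (v ^+ 2 + s ^+ 2 - s * v) / (v * s ^+ 2).
        by field; apply/andP; split; lra.
      rewrite lerDl divr_ge0 //; last by rewrite mulr_ge0 ?sqr_ge0 ?ltW.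
      by have := sqr_ge0 (v - s); have := mulr_gt0 v0 s0; rewrite !expr2; lra.
    have := ler_wpM2l u0 key.
    have -> : (a / s + 1) * (q / s + 1) = a * q * s ^- 2 + (a + q) * s^-1 + 1.
      by field; lra.
    by move: (s ^- 2) (s^-1) (v^-1) => w2 w1 w; lra.
  rewrite big_split /= -mulr_sumr sumr_const_nat subSS subn0 -[(_ + 1) *+ _]mulr_natr.
  have := sum_inv_odd_sqr_le R S.
  have : 0 <= A%:R * P%:R + (A%:R + P%:R) * t%:R :> R.
    by rewrite addr_ge0 ?mulr_ge0 ?addr_ge0.
  move: (\sum_(_ <= _ < _) _) => z; move: (A%:R * P%:R) (A%:R + P%:R) => w u w0 /(ler_wpM2l w0).
  move: (S%:R : R) (t%:R : R) (t%:R^-1 : R) w0 => S' t' v w0; lra.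
have : (A * P)%:R <= (#|G| + (#|B1| + (#|B2| + #|\bigcup_(i < S.+1 | (1 <= i)%N) B3 i|)))%:R :> R.
  rewrite ler_nat; have := subset_leq_card cov.
  rewrite cardsT card_prod !card_ord => /leq_trans; apply.
  do 3![apply: leq_trans (leq_card_setU _ _) _; rewrite leq_add2l].
  by [].
have c1R : #|B1|%:R <= (A%:R / l%:R + 1) * P%:R :> R.
  apply: le_trans (_ : ((A %/ l).+1 * P)%:R <= _); first by rewrite ler_nat.
  by rewrite natrM ler_wpM2r // divle.
have c2R : #|B2|%:R <= A%:R * (P%:R / l%:R + 1) :> R.
  apply: le_trans (_ : (A * (P %/ l).+1)%:R <= _); first by rewrite ler_nat.
  by rewrite natrM ler_wpM2l // divle.
rewrite !natrD natrM.
have : 0 <= (A%:R + P%:R) * t%:R :> R by rewrite mulr_ge0 ?addr_ge0.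
move: c1R c2R c3R; move: (#|B1|%:R : R) (#|B2|%:R : R) (#|G|%:R : R) (#|_|%:R : R) => b1 b2 g b3.
by move: (t%:R^-1 : R) (l%:R^-1 : R) => v u; lra.
Qed.


From mathcomp Require Import all_classical all_reals all_analysis.
From mathcomp Require Import zify ring lra.
Import numFieldNormedType.Exports.
Local Open Scope classical_set_scope.
Local Open Scope ring_scope.

(** * Neighbourhoods of rational numbers have density of order 1 / l *)

(** The parameter [t] is fixed before [B], large enough for the remainder with [1 / t] to be small
    against the main term [A P]; then [B] grows until it absorbs the terms linear in [B]. Uniformity
    in [P] and [c] matters because both depend on [B] where the bound is applied. *)
Lemma card_coprime_pairs_near (R : realType) (m e : nat) (beta : R) :
  (0 < e)%N -> 0 < beta ->
  \forall B \near \oo, forall (l P : nat) (c : nat -> nat),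
    prime l -> coprime l (2 * m) -> (16 <= l)%N ->
    beta * B%:R / 2 <= P%:R -> P%:R <= beta * B%:R ->
    beta * B%:R ^+ 2 / (8 * e%:R)
      <= #|coprime_pairs m l B (B %/ e) P c|%:R :> R.
Proof.
move=> e0 beta0; have eR : 0 < e%:R :> R by rewrite ltr0n.
pose t := (Num.bound (128 * e%:R * m%:R * (1 + beta) / beta)).+1.
have tP : 128 * e%:R * m%:R * (1 + beta) / beta <= t%:R.
  have x0 : 0 <= 128 * e%:R * m%:R * (1 + beta) / beta by rewrite divr_ge0 ?mulr_ge0 //; lra.
  by apply: le_trans (ltW (archi_boundP x0)) _; rewrite ler_nat.
near=> B => l P c pl cl l16 P1 P2.
have B1 : (2 * e <= B)%N by near: B; exact: nbhs_infty_ge.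
have B2 : 64 * e%:R * ((1 + beta) * (1 + t%:R) + 2 * m%:R) / beta <= B%:R.
  by near: B; exact: nbhs_infty_ger.
have AB : (B %/ e <= B)%N by rewrite leq_div.
apply: le_trans (@card_coprime_pairs_ge R m l B (B %/ e) P t c pl cl AB isT).
have a1 : B%:R / (2 * e%:R) <= (B %/ e)%:R :> R.
  have : B%:R / e%:R < (B %/ e)%:R + 1 :> R.
    by rewrite ltr_pdivrMr // natr1 -natrM ltr_nat ltn_ceil.
  have : 2 <= B%:R / e%:R :> R by rewrite ler_pdivlMr // -natrM ler_nat.
  by rewrite invfM; lra.
have a2 : (B %/ e)%:R <= B%:R :> R by rewrite ler_nat.
have l2 : 2 / l%:R <= 8^-1 :> R.
  have : 16%:R <= l%:R :> R by rewrite ler_nat.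
  by rewrite ler_pdivrMr ?ltr0n ?prime_gt0 //; lra.
have tR : 0 < t%:R :> R by rewrite ltr0n.
have t2 : (1 + beta) * (2 * m%:R / t%:R) <= beta / (64 * e%:R).
  rewrite ler_pdivlMr ?mulr_gt0 //; move: tP; rewrite ler_pdivrMr // => tP.
  rewrite -(ler_pM2r tR).
  have -> : (1 + beta) * (2 * m%:R / t%:R) * (64 * e%:R) * t%:R =
     128 * e%:R * m%:R * (1 + beta) by field; lra.
  by rewrite [leRHS]mulrC.
have B3 : (1 + beta) * (1 + t%:R) + 2 * m%:R <= beta * B%:R / (64 * e%:R).
  rewrite ler_pdivlMr ?mulr_gt0 //; move: B2; rewrite ler_pdivrMr // => B2.
  by rewrite [leLHS]mulrC [leRHS]mulrC.
rewrite !natrM.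
have bR : 0 <= B%:R :> R by [].
move: (B%:R : R) ((B %/ e)%:R : R) (P%:R : R) bR B3 P1 P2 a1 a2 => b a q bR B3 P1 P2 a1 a2.
have aq : beta * b ^+ 2 / (4 * e%:R) <= a * q.
  have -> : beta * b ^+ 2 / (4 * e%:R) = (b / (2 * e%:R)) * (beta * b / 2) by field; lra.
  by rewrite ler_pM // ?divr_ge0 ?mulr_ge0 // ltW.
have h1 : (a + q) * (1 + t%:R) + 2 * m%:R * b <= b * (beta * b / (64 * e%:R)).
  apply: le_trans (ler_wpM2l bR B3).
  by have : a + q <= (1 + beta) * b; [lra|move=> /(ler_wpM2r (_ : 0 <= 1 + t%:R)) h;
    have := h (addr_ge0 ler01 (ltW tR)); lra].
have h2 : (a + q) * (2 * m%:R * b / t%:R) <= b * (b * (beta / (64 * e%:R))).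
  have le1 : a + q <= (1 + beta) * b by lra.
  have ge0 : 0 <= 2 * m%:R * b / t%:R :> R by rewrite divr_ge0 ?mulr_ge0 // ltW.
  apply: le_trans (ler_wpM2r ge0 le1) _.
  have -> : (1 + beta) * b * (2 * m%:R * b / t%:R) = b * (b * ((1 + beta) * (2 * m%:R / t%:R))).
    by ring.
  by rewrite !ler_wpM2l.
have aq0 : 0 <= a * q.
  by apply: le_trans aq; rewrite divr_ge0 ?mulr_ge0 ?sqr_ge0 // ltW.
have h3 : a * q * (5 / 8) <= a * q * (3 / 4 - 2 / l%:R).
  by apply: ler_wpM2l => //; lra.
(* In units of [beta B ^ 2 / e] the balance is [5/8 * 1/4 - 1/64 - 1/64 = 1/8], the factor [5/8]
   being [3/4] less the [2 / l <= 1/8] lost to multiples of [l]. *)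
have E1 : beta * b ^+ 2 / (8 * e%:R) = 1/8 * (beta * b ^+ 2 / e%:R) by field; lra.
have E2 : b * (beta * b / (64 * e%:R)) = 1/64 * (beta * b ^+ 2 / e%:R) by field; lra.
have E3 : b * (b * (beta / (64 * e%:R))) = 1/64 * (beta * b ^+ 2 / e%:R) by field; lra.
have E4 : beta * b ^+ 2 / (4 * e%:R) = 1/4 * (beta * b ^+ 2 / e%:R) by field; lra.
rewrite E1; rewrite E2 in h1; rewrite E3 in h2; rewrite E4 in aq.
move: (beta * b ^+ 2 / e%:R) h1 h2 aq => z h1 h2 aq.
move: (a * q) (a * q * (3 / 4 - 2 / l%:R)) (2 * m%:R * b / t%:R) h1 h2 h3 aq => u v w h1 h2 h3 aq.
lra.
Unshelve. all: by end_near.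
Qed.

Lemma measure_disjoint_balls_le (R : realType) (I : finType) (G : {set I})
    (z : I -> R) (rho : R) (E : set R) :
  0 <= rho -> measurable E ->
  (forall i, i \in G -> `[z i - rho, z i + rho]%classic `<=` E) ->
  (forall i j, i \in G -> j \in G -> i != j -> 2 * rho < `|z i - z j|) ->
  ((2 * rho * #|G|%:R)%:E <= (@lebesgue_measure R) E)%E.
Proof.
move=> rho0 mE sE sep.
pose F i := `[z i - rho, z i + rho]%classic.
have tF : trivIset [set` G] F.
  move=> i j /= iG jG [x [+ +]]; rewrite /F /= !in_itv /= => /andP [a b] /andP [c d].
  apply/eqP; apply: contraT => ij; have := sep i j iG jG ij.
  by rewrite real_ltNge ?num_real // ler_norml => /negP []; lra.
have mF i : measurable (F i) by exact: measurable_itv.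
have sub : \bigcup_(i in [set` G]) F i `<=` E by move=> x [i iG]; exact: sE.
have mU : measurable (\bigcup_(i in [set` G]) F i).
  by apply: fin_bigcup_measurable => // i _; exact: mF.
apply: (@le_trans _ _ (lebesgue_measure (\bigcup_(i in [set` G]) F i))); last first.
  by apply: le_measure; rewrite ?inE.
rewrite measure_fin_bigcup //; last by move=> i _; exact: mF.
have -> : [set` G] = [set` enum G] by apply/seteqP; split => i /=; rewrite mem_enum.
rewrite -fsbig_seq ?enum_uniq //.
rewrite (eq_bigr (fun=> (2 * rho)%:E)); last first.
  move=> i _; rewrite /F /= lebesgue_measure_itv /= lte_fin.
  case: ltP => h; first by rewrite -EFinD; congr EFin; lra.
  by congr EFin; lra.
rewrite sumEFin lee_fin big_const_seq count_predT -cardE.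
by rewrite iter_addr addr0 mulr_natr.
Qed.

(* With [K = 2 m B] and [q = m l r], [K <= r <= (1 + 1 / e) K]: the points within
   [rho] of a reduced fraction [p / q]. *)
Definition rational_balls {R : realType} (m l e B : nat) (rho : R) : set R :=
  [set x | exists r p : nat,
    [/\ (2 * m * B <= r)%N, (e * r <= e.+1 * (2 * m * B))%N,
        coprime r (m * l), coprime p (m * l * r)
      & (p <= m * l * r)%N /\ `|x - p%:R / (m * l * r)%:R| <= rho]].

(* The height [y] with [q ^ 2 y = 1 / Y] for [q = m l K], [K = 2 m B]: a point at
   this height above [p / q] is sent to height [Y] with the cusp [p / q]. *)
Definition sample_height {R : realType} (m : nat) (Y : R) (l B : nat) : R :=
  (Y * ((m * l)%:R * (2 * m * B)%:R) ^+ 2)^-1.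

(** A finite union of closed intervals: [e >= 1] forces [r <= 4 m B], and [p <= m l r]. Closedness
    is what keeps the leftover sets open when the balls are removed. *)
Lemma closed_rational_balls (R : realType) (m l e B : nat) (rho : R) :
  (0 < e)%N -> closed (rational_balls m l e B rho).
Proof.
move=> e0; pose N := (4 * m * B).+1; pose M := (m * l * N).+1.
pose D := [set rp : 'I_N * 'I_M | [/\ (2 * m * B <= rp.1)%N,
   (e * rp.1 <= e.+1 * (2 * m * B))%N, coprime rp.1 (m * l),
   coprime rp.2 (m * l * rp.1) & (rp.2 <= m * l * rp.1)%N]].
pose F (rp : 'I_N * 'I_M) : set R :=
  `[rp.2%:R / (m * l * rp.1)%:R - rho, rp.2%:R / (m * l * rp.1)%:R + rho]%classic.
have -> : rational_balls m l e B rho = \bigcup_(rp in D) F rp.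
  apply/seteqP; split => x.
    move=> [r [p [h1 h2 h3 h4 [h5 h6]]]].
    have rN : (r < N)%N by rewrite /N; nia.
    have pM : (p < M)%N.
      by rewrite /M ltnS; apply: leq_trans h5 _; rewrite leq_mul2l ltnW // orbT.
    exists (Ordinal rN, Ordinal pM) => //=.
    by move: h6; rewrite ler_distl /F /= in_itv.
  move=> [[r p] [h1 h2 h3 h4 h5]]; rewrite /F /= in_itv /= => h6.
  by exists r, p; split => //; split => //; rewrite ler_distl.
apply: closed_bigcup => [|rp _]; first exact: finite_finset.
exact: interval_closed.
Qed.

Lemma ler1_dist_nat (R : realDomainType) (u v : nat) :
  u <> v -> 1 <= `|u%:R - v%:R| :> R.
Proof.
move=> uv; rewrite ler_normr; apply/orP.
case: (ltngtP u v) => // h; [right|left]; rewrite ?opprB lerBrDl natr1 ler_nat //.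
Qed.

Lemma coprime_cross_eq (p r p' r' : nat) : (0 < p)%N ->
  coprime p r -> coprime p' r' -> (p * r' = p' * r)%N -> p = p' /\ r = r'.
Proof.
move=> p0 c c' E.
have pp' : p = p'.
  apply/eqP; rewrite eqn_dvd; apply/andP; split.
    by rewrite -(Gauss_dvdl _ c) -E dvdn_mulr.
  by rewrite -(Gauss_dvdl _ c') E dvdn_mulr.
split=> //; move: E; rewrite -pp' => /eqP; rewrite eqn_pmul2l // => /eqP.
by move=> ->.
Qed.

(** Explains the range [B %/ e] of the index: it keeps [r] within a factor [1 + 1 / e] of [K]. The
    leading 1 is absorbed because [e (a + 1) <= B]. *)
Lemma progression_bounds (m e B a : nat) : (0 < m)%N -> (a < B %/ e)%N ->
  (2 * m * B <= 1 + 2 * m * (B + a))%N /\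
  (e * (1 + 2 * m * (B + a)) <= e.+1 * (2 * m * B))%N.
Proof.
move=> m0 aA; set k := (2 * m)%N; have k0 : (0 < k)%N by rewrite muln_gt0.
rewrite mulnDr addnA; split.
  by apply: leq_trans (leq_addl 1 _) (leq_addr _ _).
have eB : (e * a.+1 <= B)%N.
  by apply: leq_trans (leq_trunc_div B e); rewrite mulnC leq_mul2r aA orbT.
have -> : (e * (1 + k * B + k * a) = e * (k * B) + (e + k * (e * a)))%N by ring.
rewrite mulSn [X in (_ <= X)%N]addnC leq_add2l.
apply: leq_trans (_ : k * (e * a.+1) <= _)%N; last by rewrite leq_mul2l eB orbT.
by rewrite mulnS mulnDr leq_add2r leq_pmull.
Qed.

Lemma progression_inj (m B i j : nat) : (0 < m)%N ->
  (1 + 2 * m * (B + i) = 1 + 2 * m * (B + j))%N -> i = j.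
Proof.
move=> m0 /eqP; rewrite eqn_add2l eqn_pmul2l ?muln_gt0 // eqn_add2l.
by move=> /eqP.
Qed.

(** All denominators share the factor [n = m l], so distinct reduced fractions over [n r] and [n r']
    with [r, r' <= 2 K] are at least [1 / (4 n K ^ 2)] apart. The balls have diameter at most
    [2 / (Y n ^ 2 K ^ 2)], hence are disjoint as soon as [Y n > 8], whatever the size of [B]. *)
Lemma measure_rational_balls_near (R : realType) (m e : nat) (Y : R) :
  (0 < m)%N -> (0 < e)%N -> 0 < Y ->
  exists (c : R) (l0 : nat), 0 < c /\ forall l, prime l -> (l0 <= l)%N ->
    forall a b : R, 0 <= a -> a < b -> b <= 1 -> \forall B \near \oo,
    ((c / l%:R * (b - a))%:E <= (@lebesgue_measure R)
       (rational_balls m l e B (sample_height m Y l B / e%:R) `&` `[a, b[%classic))%E.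
Proof.
move=> m0 e0 Y0.
have eR : 0 < e%:R :> R by rewrite ltr0n.
have mR : 0 < m%:R :> R by rewrite ltr0n.
(* The constant is exact: [2 h / e] times the count [beta B ^ 2 / (8 e)] equals [c / l * (b - a)].
   The threshold makes [l] prime to [2 m], at least 16 for the count, and [m l > 8 / Y] for
   disjointness. *)
exists (16 * e%:R ^+ 2 * Y * m%:R ^+ 3)^-1; exists (17 + 2 * m + Num.bound (8 / Y))%N.
split; first by rewrite invr_gt0 !mulr_gt0 ?exprn_gt0.
move=> l pl l0l a b a0 ab b1.
have lp0 := prime_gt0 pl.
have lR : 0 < l%:R :> R by rewrite ltr0n.
have cl : coprime l (2 * m).
  by rewrite prime_coprime //; apply/negP => /dvdn_leq; lia.
have l16 : (16 <= l)%N by lia.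
have l8 : 8 < Y * (m * l)%:R.
  have bl : (Num.bound (8 / Y))%:R <= (m * l)%:R :> R by rewrite ler_nat; nia.
  rewrite mulrC -ltr_pdivrMr //; apply: lt_le_trans bl.
  by apply: archi_boundP; rewrite divr_ge0 // ltW.
set n := (m * l)%N in l8 *.
have n0 : (0 < n)%N by rewrite muln_gt0 m0.
have nR : 0 < n%:R :> R by rewrite ltr0n.
pose beta := (b - a) * n%:R.
have beta0 : 0 < beta by rewrite mulr_gt0 // subr_gt0.
near=> B.
have B1 : (0 < B)%N by near: B; exact: nbhs_infty_gt.
have B6 : 6 / beta <= B%:R by near: B; exact: nbhs_infty_ger.
have BY : 2 / Y <= B%:R by near: B; exact: nbhs_infty_ger.
rewrite ler_pdivrMr // mulrC in B6; rewrite ler_pdivrMr // mulrC in BY.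
have BR : 0 < B%:R :> R by rewrite ltr0n.
(* With [q = n r], the offset [c] below starts the numerators above [a q + 1], and the two indices
   given up here end them below [b q - 1]. This leaves room for the balls, whose radius is at most
   [1 / q] thanks to [BY]; [B6] keeps [P >= beta B / 2] despite the loss. *)
pose P := (Num.truncn (beta * B%:R) - 2)%N.
have [tr1 tr2] : (Num.truncn (beta * B%:R))%:R <= beta * B%:R /\
    beta * B%:R < (Num.truncn (beta * B%:R))%:R + 1.
  have /andP [] := truncn_itv (ltW (mulr_gt0 beta0 BR)).
  by rewrite -natr1.
have tr3 : (2 <= Num.truncn (beta * B%:R))%N.
  by rewrite -(ler_nat R) -(lerD2r 1); apply: le_trans (ltW tr2); lra.
have PE : P%:R = (Num.truncn (beta * B%:R))%:R - 2 :> R by rewrite natrB.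
pose r a' := (1 + 2 * m * (B + a'))%N.
pose c a' := (Num.truncn ((a * (n * r a')%:R + 1) / (2 * m)%:R)).+1.
pose p a' b' := (1 + 2 * m * (c a' + b'))%N.
have cnt : beta * B%:R ^+ 2 / (8 * e%:R)
      <= #|coprime_pairs m l B (B %/ e) P c|%:R :> R.
  (* Restated for all [P] and [c], since those at hand are built from [B]. *)
  suff: forall (l P : nat) (c : nat -> nat),
    prime l -> coprime l (2 * m) -> (16 <= l)%N ->
    beta * B%:R / 2 <= P%:R -> P%:R <= beta * B%:R ->
    beta * B%:R ^+ 2 / (8 * e%:R)
      <= #|coprime_pairs m l B (B %/ e) P c|%:R :> R.
    by apply => //; rewrite PE; lra.
  by near: B; exact: card_coprime_pairs_near.
set G := coprime_pairs _ _ _ _ _ _ in cnt.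
pose K := (2 * m * B)%N.
have K0 : (0 < K)%N by rewrite !muln_gt0 m0 B1.
have KR : 0 < K%:R :> R by rewrite ltr0n.
pose N : R := n%:R * K%:R.
have N0 : 0 < N by rewrite mulr_gt0.
have YN : 2 <= Y * N.
  apply: le_trans BY _; rewrite ler_pM2l // /N -natrM ler_nat.
  by apply: leq_trans (leq_pmull _ n0); rewrite /K leq_pmull // muln_gt0.
have hE : sample_height m Y l B = (Y * N ^+ 2)^-1 by [].
have h0 : 0 < sample_height m Y l B by rewrite hE invr_gt0 mulr_gt0 ?exprn_gt0.
set h := sample_height m Y l B in hE h0 *.
have rle a' : (a' < B %/ e)%N -> (K <= r a')%N /\ (e * r a' <= e.+1 * K)%N.
  exact: progression_bounds.
have rle2 a' : (a' < B %/ e)%N -> (r a' <= 2 * K)%N.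
  move=> /rle [_ hr]; rewrite -(leq_pmul2l e0); apply: leq_trans hr _.
  by rewrite mulnA leq_mul2r; apply/orP; right; clear -e0; lia.
have rgt a' : (0 < r a')%N by rewrite /r.
have rhole : h / e%:R <= h by rewrite ler_pdivrMr // ler_peMr ?ler1n // ltW.
pose z (ab : 'I_(B %/ e) * 'I_P) : R := (p ab.1 ab.2)%:R / (n * r ab.1)%:R.
have in_ab (w : 'I_(B %/ e) * 'I_P) x : `|x - z w| <= h / e%:R -> a <= x < b.
  move=> xz; set q : R := (n * r w.1)%:R.
  have q0 : 0 < q by rewrite ltr0n muln_gt0 n0.
  have [rK _] := rle _ (ltn_ord w.1).
  have Nq : N <= q by rewrite /N /q natrM ler_pM2l // ler_nat.
  have qN : q <= 2 * N.
    by rewrite /N /q natrM mulrCA ler_pM2l // -natrM ler_nat rle2.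
  have hq : h * q <= 1.
    rewrite hE mulrC ler_pdivrMr ?mul1r ?mulr_gt0 ?exprn_gt0 //.
    apply: le_trans qN _; rewrite expr2 mulrA ler_pM2r //.
  set v := (a * q + 1) / (2 * m)%:R.
  have m2 : 0 < (2 * m)%:R :> R by rewrite ltr0n muln_gt0.
  have v0 : 0 <= v by rewrite divr_ge0 // addr_ge0 // mulr_ge0 // ltW.
  have /andP [cv1 cv2] := truncn_itv v0.
  have cE : (c w.1)%:R = (Num.truncn v)%:R + 1 :> R by rewrite /c -natr1.
  rewrite -natr1 in cv2.
  have vE : (2 * m)%:R * v = a * q + 1 by rewrite mulrC divfK // gt_eqF.
  have p1 : a * q + 1 < (p w.1 w.2)%:R.
    rewrite -vE; apply: lt_le_trans (_ : (2 * m)%:R * (c w.1)%:R <= _).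
      by rewrite ltr_pM2l // cE.
    by rewrite -natrM ler_nat /p mulnDr addnA addnAC leq_addl.
  have bP : (w.2)%:R + 1 <= P%:R :> R by rewrite natr1 ler_nat ltn_ord.
  have p2 : (p w.1 w.2)%:R + 1 < b * q.
    have -> : (p w.1 w.2)%:R = 1 + (2 * m)%:R * ((Num.truncn v)%:R + 1 + (w.2)%:R) :> R.
      by rewrite /p natrD natrM natrD cE.
    have : (2 * m)%:R * ((Num.truncn v)%:R + 1 + (w.2)%:R) <=
       (2 * m)%:R * (v + (beta * B%:R - 2)).
      by rewrite ler_pM2l //; lra.
    have : (2 * m)%:R * (beta * B%:R) <= (b - a) * q.
      have -> : (2 * m)%:R * (beta * B%:R) = (b - a) * N by rewrite /N /K /beta !natrM; ring.
      by rewrite ler_wpM2l // subr_ge0 ltW.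
    have : 2 <= (2 * m)%:R :> R by rewrite ler_nat leq_pmulr.
    rewrite !mulrDr vE; lra.
  have zq : z w * q = (p w.1 w.2)%:R by rewrite /z divfK // gt_eqF.
  have h2 : h / e%:R * q <= 1 by apply: le_trans hq; rewrite ler_pM2r.
  move: xz; rewrite ler_distl => /andP [x1 x2].
  rewrite -(ler_pM2r q0) in x1; rewrite -(ler_pM2r q0) in x2.
  rewrite -(ler_pM2r q0) -(ltr_pM2r q0).
  by apply/andP; split; lra.
have sep (i j : 'I_(B %/ e) * 'I_P) : i \in G -> j \in G -> i != j ->
    2 * (h / e%:R) < `|z i - z j|.
  case: i j => [i1 i2] [j1 j2]; rewrite !inE /= => /andP [_ ci] /andP [_ cj] ij.
  have {}ci : coprime (p i1 i2) (r i1) by move: ci; rewrite coprimeMr => /andP [].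
  have {}cj : coprime (p j1 j2) (r j1) by move: cj; rewrite coprimeMr => /andP [].
  have ne : (p i1 i2 * r j1)%N <> (p j1 j2 * r i1)%N.
    move=> E; have [E1 E2] := coprime_cross_eq _ _ _ _ (isT : (0 < p i1 i2)%N) ci cj E.
    have e1 : i1 = j1 by apply: val_inj; exact: progression_inj _ _ _ _ m0 E2.
    move: E1 ij; rewrite e1 /p => E1; rewrite -[_ == _]negbK => /negP; apply.
    rewrite negbK; apply/eqP; congr (_, _); by apply: val_inj; exact: progression_inj _ _ _ _ m0 E1.
  have r1 : 0 < (r i1)%:R :> R by rewrite ltr0n.
  have r2 : 0 < (r j1)%:R :> R by rewrite ltr0n.
  have -> : z (i1, i2) - z (j1, j2) =
     ((p i1 i2 * r j1)%:R - (p j1 j2 * r i1)%:R) / (n%:R * (r i1)%:R * (r j1)%:R).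
    by rewrite /z /= !natrM; field; rewrite !gt_eqF.
  have dp : 0 < n%:R * (r i1)%:R * (r j1)%:R :> R by rewrite !mulr_gt0.
  rewrite normrM normfV (gtr0_norm dp) ltr_pdivlMr //.
  apply: lt_le_trans (ler1_dist_nat R _ _ ne).
  have dle : n%:R * (r i1)%:R * (r j1)%:R <= 4 * N ^+ 2 / n%:R.
    have -> : 4 * N ^+ 2 / n%:R = n%:R * (2 * K%:R) * (2 * K%:R).
      by rewrite /N; field; rewrite gt_eqF.
    have le2 a' : (a' < B %/ e)%N -> (r a')%:R <= 2 * K%:R :> R.
      by move=> /rle2; rewrite -natrM ler_nat.
    by rewrite -!mulrA ler_pM2l // mulrA ler_pM // ?le2 // ltW.
  apply: le_lt_trans (_ : 2 * h * (4 * N ^+ 2 / n%:R) < 1).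
    by rewrite ler_pM ?mulr_ge0 ?divr_ge0 ?ler_pM2l // ltW.
  have -> : 2 * h * (4 * N ^+ 2 / n%:R) = 8 / (Y * n%:R).
    by rewrite hE; field; rewrite !gt_eqF.
  by rewrite ltr_pdivrMr ?mul1r // mulr_gt0.
apply: (@le_trans _ _ (2 * (h / e%:R) * #|G|%:R)%:E).
  rewrite lee_fin.
  apply: le_trans (_ : 2 * (h / e%:R) * (beta * B%:R ^+ 2 / (8 * e%:R)) <= _); last first.
    by rewrite ler_wpM2l // mulr_ge0 ?divr_ge0 // ltW.
  rewrite hE /beta /N /K /n !natrM le_eqVlt; apply/orP; left; apply/eqP.
  by field; rewrite !gt_eqF.
apply: (@measure_disjoint_balls_le _ _ G z).
- by rewrite divr_ge0 // ltW.
- apply: measurableI; last exact: measurable_itv.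
  by apply: measurable_realfun.closed_measurable; exact: closed_rational_balls.
- move=> w; rewrite inE => /andP [lr cp] x; rewrite /= in_itv /= => xz.
  have xz' : `|x - z w| <= h / e%:R by rewrite ler_distl.
  have xab := in_ab _ _ xz'; split; last by rewrite in_itv.
  have [r1 r2] := rle _ (ltn_ord w.1).
  exists (r w.1), (p w.1 w.2); split => //.
    rewrite coprimeMr; apply/andP; split; last by rewrite coprime_sym prime_coprime.
    rewrite coprime_sym /coprime.
    have -> : (r w.1 = 2 * (B + w.1) * m + 1)%N by rewrite /r; ring.
    by rewrite gcdnMDl gcdn1.
  split=> //.
  have zz : `|z w - z w| <= h / e%:R by rewrite subrr normr0 divr_ge0 // ltW.
  have /andP [_] := in_ab w (z w) zz.
  rewrite /z ltr_pdivrMr ?ltr0n ?muln_gt0 ?m0 ?lp0 // => pq.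
  rewrite -(ler_nat R); apply: le_trans (ltW pq) _.
  by rewrite ler_piMl.
- exact: sep.
Unshelve. all: by end_near.
Qed.

(** * Inner approximation of open sets by dyadic intervals *)

Definition dyadic {R : realType} (J i : nat) : set R :=
  `[i%:R / 2 ^+ J, (i%:R + 1) / 2 ^+ J[%classic.

Definition dyadic_core {R : realType} (U : set R) (J : nat) : set R :=
  \bigcup_(i in [set i : 'I_(2 ^ J) | dyadic J i `<=` U]) dyadic J i.

Lemma dyadicE (R : realType) (J i : nat) (x : R) :
  dyadic J i x <-> i%:R <= x * 2 ^+ J < i%:R + 1.
Proof.
rewrite /dyadic /= in_itv /=; have T0 : 0 < 2 ^+ J :> R by rewrite exprn_gt0.
by rewrite ler_pdivrMr // ltr_pdivlMr.
Qed.

Lemma dyadic_core_nondecreasing (R : realType) (U : set R) :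
  nondecreasing_seq (dyadic_core U).
Proof.
apply/nondecreasing_seqP => J; apply/subsetPset => x [i iU /dyadicE xi].
have iJ := ltn_ord i.
have [j [ji xj]] : exists j, (j./2 = i)%N /\ dyadic J.+1 j x.
  have [h|h] := ltP (x * 2 ^+ J.+1) (2 * i%:R + 1).
    exists (2 * i)%N; split; first by rewrite mul2n doubleK.
    by apply/dyadicE; rewrite natrM h exprSr mulrA; lra.
  exists (2 * i).+1; split; first by rewrite mul2n /= uphalf_double.
  by apply/dyadicE; rewrite -natr1 natrM h exprSr mulrA; lra.
have jJ : (j < 2 ^ J.+1)%N by rewrite expnS; lia.
have j1 : 2 * i%:R <= j%:R :> R by rewrite -natrM ler_nat; lia.
have j2 : j%:R <= 2 * i%:R + 1 :> R by rewrite -natrM natr1 ler_nat; lia.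
exists (Ordinal jJ) => //= y /dyadicE yj; apply: iU; apply/dyadicE.
by move: yj; rewrite exprSr mulrA; lra.
Qed.

Lemma bigcup_dyadic_core (R : realType) (U : set R) : open U ->
  U `<=` `[0, 1[%classic -> \bigcup_J dyadic_core U J = U.
Proof.
move=> oU U01; apply/seteqP; split => x.
  by move=> [J _ [i iU xi]]; exact: iU.
move=> Ux; have := U01 _ Ux; rewrite /= in_itv /= => /andP [x0 x1].
have /nbhs_ballP [eps /= eps0 sub] : nbhs x U by exact: open_nbhs_nbhs.
pose J := Num.bound eps^-1.
have T0 : 0 < 2 ^+ J :> R by rewrite exprn_gt0.
have JT : eps^-1 < 2 ^+ J.
  apply: lt_trans (archi_boundP _) _; first by rewrite invr_ge0 ltW.
  by rewrite -natrX ltr_nat ltn_expl.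
have eT : 1 < eps * 2 ^+ J by rewrite -ltr_pdivrMl // mulr1.
have xT : 0 <= x * 2 ^+ J by rewrite mulr_ge0 // ltW.
have /andP [t1 t2] : (Num.truncn (x * 2 ^+ J))%:R <= x * 2 ^+ J
    < (Num.truncn (x * 2 ^+ J))%:R + 1 by rewrite natr1 truncn_itv.
have iJ : (Num.truncn (x * 2 ^+ J) < 2 ^ J)%N.
  by rewrite truncn_lt_nat // natrX gtr_pMl.
exists J => //; exists (Ordinal iJ) => /=; last by apply/dyadicE => /=; rewrite t1 t2.
move=> y /dyadicE yi; apply: sub; rewrite /ball /= ltr_distlC.
rewrite -(ltr_pM2r T0) -(ltr_pM2r T0 y); apply/andP; split; lra.
Qed.

Lemma measurable_dyadic (R : realType) (J i : nat) : measurable (dyadic J i : set R).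
Proof. exact: measurable_itv. Qed.

Lemma measurable_dyadic_core (R : realType) (U : set R) (J : nat) :
  measurable (dyadic_core U J).
Proof. by apply: fin_bigcup_measurable => // i _; exact: measurable_dyadic. Qed.

Lemma measure_dyadic (R : realType) (J i : nat) :
  (@lebesgue_measure R) (dyadic J i) = (2 ^- J)%:E.
Proof.
have T0 : 0 < 2 ^- J :> R by rewrite invr_gt0 exprn_gt0.
rewrite /dyadic lebesgue_measure_itv /= lte_fin mulrDl mul1r ltrDl T0.
by rewrite -EFinD; congr EFin; lra.
Qed.

Lemma trivIset_dyadic (R : realType) (J : nat) (D : set 'I_(2 ^ J)) :
  trivIset D (fun i => dyadic J i : set R).
Proof.
move=> i j _ _ [x [/dyadicE xi /dyadicE xj]]; apply: val_inj => /=.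
apply/eqP; rewrite eqn_leq -ltnS -[X in _ && X]ltnS -!(ltr_nat R) -!natr1; lra.
Qed.

(* An asymptotic lower bound on intervals passes to open sets through the union
   of the dyadic intervals they contain. *)
Lemma measure_setD_open_near (R : realType) (A : nat -> set R) (kappa : R) (U : set R) :
  0 <= kappa -> (forall B, measurable (A B)) ->
  (forall a b : R, 0 <= a -> a < b -> b <= 1 -> \forall B \near \oo,
    ((kappa * (b - a))%:E <= (@lebesgue_measure R) (A B `&` `[a, b[%classic))%E) ->
  open U -> U `<=` `[0, 1[%classic ->
  \forall B \near \oo,
    ((@lebesgue_measure R) (U `\` A B) <=
       (1 - kappa / 2)%:E * (@lebesgue_measure R) U)%E.
Proof.
move=> k0 mA hA oU U01; set mu := @lebesgue_measure R.
have mU : measurable U by exact: measurable_realfun.open_measurable.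
have muU1 : (mu U <= 1)%E.
  apply: le_trans (_ : mu `[0%R, 1%R[%classic <= _)%E.
    by apply: le_measure; rewrite ?inE.
  by rewrite /mu lebesgue_measure_itv /= lte_fin ltr01 -EFinD subr0.
have muUfin : mu U \is a fin_num.
  by rewrite ge0_fin_numE // (le_lt_trans muU1) // ltry.
pose u := fine (mu U); have uE : mu U = u%:E by rewrite fineK.
have u0 : 0 <= u by rewrite fine_ge0.
have DE B : mu (U `\` A B) = (mu U - mu (U `&` A B))%E.
  apply: measureD; [exact: mU|exact: mA|exact: (le_lt_trans muU1 (ltry 1))].
(* A null [U] is set apart: the strict bound by [u / 2] below needs [u > 0]. *)
have [/eqP uz|un0] := eqVneq u 0.
  have mu0 : mu U = 0%E by rewrite uE (eqP uz).
  apply: nearW => B.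
  have le : (mu (U `\` A B) <= mu U)%E.
    apply: le_measure; rewrite ?inE; [exact: (measurableD mU (mA B))|exact: mU|exact: subDsetl].
  by rewrite mu0 mule0 -mu0.
have {un0}u0 : 0 < u by rewrite lt_neqAle eq_sym un0.
(* Capturing half of the measure accounts for the [kappa / 2] of the conclusion. The level [J] is
   fixed before [B], so only finitely many intervals have to be handled at once. *)
have [J hJ] : exists J, ((u / 2)%:E < mu (dyadic_core U J))%E.
  have cv : mu \o dyadic_core U @ \oo --> mu U.
    have mc J := measurable_dyadic_core R U J.
    have := @nondecreasing_cvg_mu _ _ R (@lebesgue_measure R) (dyadic_core U) mc
      (bigcup_measurable (fun J _ => mc J)) (dyadic_core_nondecreasing R U).
    by rewrite bigcup_dyadic_core.
  have : \forall J \near \oo, ((u / 2)%:E < (mu \o dyadic_core U) J)%E.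
    apply: (cv [set y | ((u / 2)%:E < y)%E]); apply: open_nbhs_nbhs.
    split; first exact: open_ereal_gt_ereal.
    by rewrite /= uE lte_fin; lra.
  by move=> [J _ /(_ J (leqnn J))]; exists J.
have cells : \forall B \near \oo, forall i : 'I_(2 ^ J),
   ((kappa * 2 ^- J)%:E <= mu (A B `&` dyadic J i))%E.
  apply: filter_forall => i.
  have T0 : 0 < 2 ^+ J :> R by rewrite exprn_gt0.
  have := hA (i%:R / 2 ^+ J) ((i%:R + 1) / 2 ^+ J).
  have -> : (i%:R + 1) / 2 ^+ J - i%:R / 2 ^+ J = 2 ^- J :> R by rewrite mulrDl mul1r; lra.
  apply.
  - by rewrite divr_ge0 // ltW.
  - by rewrite ltr_pM2r ?invr_gt0 // ltrDl.
  - by rewrite ler_pdivrMr // mul1r natr1 -natrX ler_nat.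
near=> B.
have cB : forall i : 'I_(2 ^ J), ((kappa * 2 ^- J)%:E <= mu (A B `&` dyadic J i))%E.
  by near: B.
pose D := [set i : 'I_(2 ^ J) | dyadic J i `<=` U].
have coreE : mu (dyadic_core U J) = (\sum_(i \in D) (2 ^- J : R)%:E)%E.
  rewrite /dyadic_core /mu measure_fin_bigcup; [|exact: finite_finset| |].
  - by apply: eq_fsbigr => i _; exact: measure_dyadic.
  - exact: trivIset_dyadic.
  - by move=> i _; exact: measurable_dyadic.
have AUE : ((\sum_(i \in D) (kappa * 2 ^- J : R)%:E) <= mu (U `&` A B))%E.
  apply: (@le_trans _ _ (mu (\bigcup_(i in D) (A B `&` dyadic J i)))); last first.
    apply: le_measure; rewrite ?inE.
    - apply: fin_bigcup_measurable => // i _.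
      exact: (measurableI _ _ (mA B) (measurable_dyadic R J i)).
    - exact: (measurableI _ _ mU (mA B)).
    - by move=> x [i iU [Ax ix]]; split => //; exact: iU.
  rewrite /mu measure_fin_bigcup; [|exact: finite_finset| |].
  - by apply: lee_fsum => [|i _]; [exact: finite_finset|exact: cB].
  - by apply: trivIset_setIl; exact: trivIset_dyadic.
  - by move=> i _; exact: (measurableI _ _ (mA B) (measurable_dyadic R J i)).
have fin : mu (U `&` A B) \is a fin_num.
  rewrite ge0_fin_numE //; apply: le_lt_trans (_ : mu U < _)%E.
    apply: le_measure; rewrite ?inE; last exact: subIsetl.
      exact: (measurableI _ _ mU (mA B)).
    exact: mU.
  by rewrite uE ltry.
rewrite DE uE -(fineK fin) -EFinD -EFinM lee_fin.
move: AUE hJ; rewrite coreE -(fineK fin).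
rewrite !fsumEFin; [|exact: finite_finset..]; rewrite lte_fin lee_fin -mulr_fsumr => h1 h2.
have := ler_wpM2l k0 (ltW h2); lra.
Unshelve. all: by end_near.
Qed.

(** * Sample points near a rational number *)

(** The terms matched by [tau] cancel. What remains on either side has as many terms as the
    complement of [P], each bounded by [M]. *)
Lemma ler_dist_sum_partial_inj (R : realDomainType) (I : finType) (g F : I -> R)
    (P : pred I) (tau : I -> I) (M : R) :
  {in P &, injective tau} -> (forall i, P i -> g i = F (tau i)) ->
  (forall i, `|g i| <= M) -> (forall i, `|F i| <= M) ->
  `|\sum_i g i - \sum_i F i| <= 2 * M *+ #|[predC P]|.
Proof.
move=> tinj gF gM FM.
pose Q := [predC tau @: P].
have QP : #|Q| = #|[predC P]|.
  have := cardC P; rewrite -(cardC (tau @: P)) (card_in_imset tinj).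
  by move=> /addnI.
rewrite (bigID P) /= [X in _ - X](bigID (mem (tau @: P))) /= big_imset //=.
rewrite (eq_bigr _ gF) [X in _ - (X + _)](_ : _ = \sum_(i | P i) F (tau i)) //.
rewrite opprD addrACA subrr add0r; apply: le_trans (ler_normB _ _) _.
rewrite mulr2n mulrDl mul1r mulrnDl; apply: lerD.
  apply: le_trans (ler_norm_sum _ _ _) _; rewrite -sumr_const.
  by apply: ler_sum.
rewrite -QP; apply: le_trans (ler_norm_sum _ _ _) _; rewrite -sumr_const.
by apply: ler_sum.
Qed.

Lemma invariant_translate (R : realType) (f : R * R -> R) : SL2Z_invariant f ->
  forall (z : int) (x y : R), 0 < y -> f (x + z%:~R, y) = f (x, y).
Proof.
move=> inv z x y y0.
have := inv 1 z 0 1 _ (x, y); rewrite mul1r mulr0 subr0 => /(_ erefl) <-.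
  by rewrite /mobius /= !(mul0r, mul1r, mulr0, addr0, add0r, expr0n, expr1n, mulr1, divr1).
by rewrite inE.
Qed.

(** Real form of the identity [g (a / q + w) = u / q - 1 / (q ^ 2 w)] with [w = s + i y], for the
    matrix [g] with rows [(u, v)] and [(q, - a)], which sends the cusp [a / q] to infinity. *)
Lemma mobius_at_cusp (R : realType) (u v : int) (a q : nat) (s y : R) : (0 < q)%N -> 0 < y ->
  u * - a%:Z - v * q%:Z = 1 ->
  mobius u v q%:Z (- a%:Z) (a%:R / q%:R + s, y) =
  (u%:~R / q%:R - s / (q%:R ^+ 2 * (s ^+ 2 + y ^+ 2)),
   y / (q%:R ^+ 2 * (s ^+ 2 + y ^+ 2))).
Proof.
move=> q0 y0 /(congr1 (fun z : int => z%:~R : R)).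
rewrite intrB !intrM mulrNz -![_%:Z%:~R]pmulrn.
have qR : q%:R != 0 :> R by rewrite pnatr_eq0 -lt0n.
have sy0 : s ^+ 2 + y ^+ 2 != 0.
  by rewrite gt_eqF // ltr_wpDl ?sqr_ge0 // exprn_gt0.
move=> E; have vE : v%:~R = (- u%:~R * a%:R - 1) / q%:R :> R.
  by apply: (canRL (mulfK qR)); lra.
rewrite /mobius /= mulrNz -![_%:Z%:~R]pmulrn vE.
have -> : q%:R * (a%:R / q%:R + s) + - a%:R = q%:R * s by field.
have -> : (q%:R * s) ^+ 2 + (q%:R * y) ^+ 2 = q%:R ^+ 2 * (s ^+ 2 + y ^+ 2) by ring.
by congr (_, _); field; rewrite qR sy0.
Qed.

(* The cusps [(a0 + D k) / (D l)] with [l] not dividing the numerator are sent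
   to infinity by matrices whose upper left entries run through a progression
   [u0 + D t] modulo [D l], with [t] an injective function of [k]. *)
Lemma sum_translates_at_cusps (R : realType) (f : R * R -> R) (M : R)
    (a0 D l : nat) (s y : R) :
  SL2Z_invariant f -> (forall p, p \in @upper_half R -> `|f p| <= M) ->
  prime l -> coprime D l -> coprime a0 D -> (0 < D)%N -> 0 < y ->
  exists theta : R,
    `|\sum_(k < l) f ((a0 + D * k)%:R / (D * l)%:R + s, y) -
      \sum_(t < l) f (theta + t%:R / l%:R,
                      y / ((D * l)%:R ^+ 2 * (s ^+ 2 + y ^+ 2)))| <= 4 * M.
Proof.
move=> inv fM pl cDl ca0 D0 y0.
have l0 := prime_gt0 pl.
have q0 : (0 < D * l)%N by rewrite muln_gt0 D0.
have [[b1 b2] /= Eb] : exists uv, uv.1 * a0%:Z + uv.2 * D%:Z = 1.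
  by apply/coprimezP.
(* Modulo [D], [u0 a0 = -1]. A matrix sending one of these cusps to infinity has an upper left entry
   [u] with the same property, so [u] is congruent to [u0] modulo [D]. *)
pose u0 : int := - b1.
set h := y / _; have h0 : 0 < h.
  rewrite divr_gt0 // mulr_gt0 ?exprn_gt0 ?ltr0n //.
  by rewrite ltr_wpDl ?sqr_ge0 // exprn_gt0.
pose theta : R := u0%:~R / (D * l)%:R - s / ((D * l)%:R ^+ 2 * (s ^+ 2 + y ^+ 2)).
pose F (t : 'I_l) := f (theta + t%:R / l%:R, h).
pose g (k : 'I_l) := f ((a0 + D * k)%:R / (D * l)%:R + s, y).
pose P := [pred k : 'I_l | ~~ (l %| a0 + D * k)%N].
have ex (k : 'I_l) : exists t : 'I_l, P k ->
    ((D * l)%:Z %| (u0 + D%:Z * t%:Z) * (a0 + D * k)%:Z + 1)%Z /\ g k = F t.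
  case: (boolP (P k)) => Pk; last by exists (Ordinal l0).
  have cq : coprime (a0 + D * k) (D * l).
    rewrite coprimeMr; apply/andP; split; last by rewrite coprime_sym prime_coprime.
    by rewrite coprime_sym /coprime addnC mulnC gcdnMDl -/(coprime _ _) coprime_sym.
  have [[c1 c2] /= Ec] : exists uv, uv.1 * (a0 + D * k)%:Z + uv.2 * (D * l)%:Z = 1.
    by apply/coprimezP.
  pose u := - c1.
  have /dvdzP [t' Et'] : (D%:Z %| u - u0)%Z.
    have : (D%:Z %| a0%:Z * (u - u0))%Z.
      apply/dvdzP; exists (c1 * k%:Z + c2 * l%:Z - b2).
      move: Eb Ec; rewrite /u /u0 PoszD !PoszM => Eb Ec.
      have -> : a0%:Z * (- c1 - - b1) = (b1 * a0%:Z) - c1 * a0%:Z by ring.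
      have -> : b1 * a0%:Z = 1 - b2 * D%:Z by rewrite -Eb; ring.
      rewrite -[X in X - b2 * _]Ec; ring.
    by rewrite Gauss_dvdzr // coprimez_sym.
  have lz : (l%:Z != 0) by rewrite eqz_nat -lt0n.
  have tl : (`|(t' %% l%:Z)%Z| < l)%N.
    rewrite -ltz_nat gez0_abs ?modz_ge0 //; exact: ltz_pmod.
  exists (Ordinal tl) => _ /=; rewrite gez0_abs ?modz_ge0 //.
  have Eu : u = u0 + D%:Z * (t' %% l%:Z)%Z + (D * l)%:Z * (t' %/ l%:Z)%Z.
    have -> : u = u0 + t' * D%:Z by rewrite -Et'; ring.
    rewrite {1}(divz_eq t' l%:Z) PoszM; ring.
  split.
    apply/dvdzP; exists (c2 - (t' %/ l%:Z)%Z * (a0 + D * k)%:Z).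
    have -> : u0 + D%:Z * (t' %% l%:Z)%Z = - c1 - (D * l)%:Z * (t' %/ l%:Z)%Z.
      by rewrite -/u Eu; ring.
    by rewrite -[X in _ + X]Ec; ring.
  rewrite /g -(inv u (- c2) (D * l)%:Z (- (a0 + D * k)%:Z)) ?inE //=; last first.
    by rewrite -Ec /u; ring.
  rewrite mobius_at_cusp // ?[(_, _)]/=; last by rewrite -Ec /u; ring.
  rewrite -/h /F -(invariant_translate _ _ inv (- (t' %/ l%:Z)%Z) (_ + _)) //.
  congr (f (_, _)); rewrite /theta Eu !rmorphD /= !intrM -![_%:Z%:~R]pmulrn mulrNz.
  have -> : (`|(t' %% l%:Z)%Z|%N)%:R = (t' %% l%:Z)%Z%:~R :> R.
    by rewrite pmulrn gez0_abs ?modz_ge0.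
  rewrite natrM; set W := s / _; have Dn0 : D%:R != 0 :> R by rewrite pnatr_eq0 -lt0n.
  have ln0 : l%:R != 0 :> R by rewrite pnatr_eq0 -lt0n.
  by field; rewrite Dn0 ln0.
have [tau Htau] := choice ex.
exists theta; apply: le_trans (_ : 2 * M *+ #|[predC P]| <= _).
  apply: (@ler_dist_sum_partial_inj _ _ g F P tau).
  (* The index [t] fixes [u] modulo [D l]; as [u] is invertible there and [u (a0 + D k) = -1], it
     also fixes [k] modulo [l]. *)
  - move=> k k' Pk Pk' tE.
    have [d1 _] := Htau k Pk; have [d2 _] := Htau k' Pk'.
    rewrite tE in d1.
    set w := u0 + _ in d1 d2.
    have cw : coprimez (D * l)%:Z w.
      case/dvdzP: d2 => c Ec; rewrite coprimez_sym; apply/coprimezP.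
      exists (- (a0 + D * k')%:Z, c) => /=; rewrite -Ec; ring.
    have : ((D * l)%:Z %| w * (D%:Z * (k%:Z - k'%:Z)))%Z.
      have -> : w * (D%:Z * (k%:Z - k'%:Z)) =
          (w * (a0 + D * k)%:Z + 1) - (w * (a0 + D * k')%:Z + 1).
        by rewrite !PoszD !PoszM; ring.
      by rewrite rpredB.
    rewrite Gauss_dvdzr // PoszM dvdz_mul2l ?eqz_nat -?lt0n // -eqz_mod_dvd !modz_nat.
    by rewrite !modn_small // eqz_nat => /eqP /val_inj.
  - by move=> k Pk; have [] := Htau k Pk.
  - by move=> k; apply: fM; rewrite inE.
  - by move=> k; apply: fM; rewrite inE.
have M0 : 0 <= M by apply: le_trans (fM (0, 1) _) => //; rewrite inE /upper_half /=.
(* The exceptional [k] form a single class modulo [l]; the general count bounds them by 2, whence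
   the constant [4 M]. *)
have : (#|[predC P]| <= 2)%N.
  have := card_dvd_progression l l a0 D l0 _; rewrite coprime_sym cDl divnn l0 => /(_ isT).
  apply: leq_trans; apply: subset_leq_card; apply/fintype.subsetP => k.
  by rewrite !inE negbK.
rewrite -mulr_natr => c2; rewrite (_ : 4 * M = 2 * M * 2%:R); last by ring.
by apply: ler_wpM2l; rewrite ?mulr_ge0 ?ler_nat.
Qed.

(** * Equally spaced points on a horocycle *)

Lemma open_upper_half (R : realType) : open (@upper_half R).
Proof.
have -> : @upper_half R = snd @^-1` [set z : R | 0 < z] by [].
apply: open_comp; last exact: open_gt.
by move=> p _; exact: cvg_snd.
Qed.

(** Compactness of the segment at height [Y], in its near-covering form along [d] tending to 0 from
    the right. Only [t] is confined to [[0, 1]]: the sample points may overshoot the segment and lie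
    at a height merely close to [Y]. *)
Lemma unif_continuous_horizontal (R : realType) (f : R * R -> R) (Y eta : R) :
  {within @upper_half R, continuous f} -> 0 < Y -> 0 < eta ->
  exists2 delta : R, 0 < delta & forall t t' h : R, 0 <= t <= 1 ->
    `|t' - t| <= delta -> `|h - Y| <= delta -> `|f (t', h) - f (t, Y)| <= eta.
Proof.
move=> cf Y0 eta0.
have uhO := open_upper_half R.
have cfp (t : R) : f @ ((t, Y) : R * R) --> f (t, Y).
  have := cf; rewrite continuous_open_subspace // => /(_ (t, Y)); apply.
  by rewrite inE.
have K : compact (`[0, 1]%classic : set R) by exact: segment_compact.
move/compact_near_coveringP : K => /(_ R ((0:R)^'+)
  (fun d t => forall t' h : R, `|t' - t| <= d -> `|h - Y| <= d ->
     `|f (t', h) - f (t, Y)| <= eta) _) cov.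
have : \forall d \near (0:R)^'+, forall t, `[0, 1]%classic t ->
   forall t' h : R, `|t' - t| <= d -> `|h - Y| <= d ->
     `|f (t', h) - f (t, Y)| <= eta.
  apply: cov => t _.
  have e2 : 0 < eta / 2 by rewrite divr_gt0.
  have /cvgrPdist_le /(_ _ e2) /nbhs_ballP [eps /= eps0 sub] := cfp t.
  exists (ball t (eps / 2), [set d : R | 0 < d < eps / 2]); first split => /=.
  - by apply: nbhsx_ballx; rewrite divr_gt0.
  - near=> d; apply/andP; split; near: d; first exact: nbhs_right_gt.
    by apply: nbhs_right_lt; rewrite divr_gt0.
  - move=> [t1 d] [/= bt1 /andP [d0 d1]] t' h ht' hh.
    rewrite /ball /= in bt1.
    have s1 : `|f (t, Y) - f (t', h)| <= eta / 2.
      apply: (sub (t', h)); split; rewrite /ball /= distrC.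
        rewrite (_ : t' - t = (t' - t1) - (t - t1)); last by ring.
        by apply: le_lt_trans (ler_normB _ _) _; lra.
      by apply: le_lt_trans hh _; lra.
    have s2 : `|f (t, Y) - f (t1, Y)| <= eta / 2.
      apply: (sub (t1, Y)); split; rewrite /ball /=; first by lra.
      by rewrite subrr normr0.
    rewrite (_ : _ - _ = (f (t, Y) - f (t1, Y)) - (f (t, Y) - f (t', h))); last by ring.
    by apply: le_trans (ler_normB _ _) _; lra.
move=> H; have [d [Hd d0]] := @filter_ex _ _ _ _ (filterI H (nbhs_right_gt (0:R))).
exists d => // t t' h t01; apply: Hd => /=.
by rewrite in_itv.
Unshelve. all: by end_near.
Qed.

(** Moving [theta] by a multiple of [1 / l] permutes the points modulo 1. After the reduction the
    point of index [t] is within [1 / l] of every point of the cell from [t / l] to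
    [(t + 1) / l]. *)
Lemma sum_shift_mod (R : realType) (F : R -> R) (theta : R) (l : nat) : (0 < l)%N ->
  (forall (z : int) x, F (x + z%:~R) = F x) ->
  exists theta', 0 <= theta' <= l%:R^-1 /\
    \sum_(t < l) F (theta + t%:R / l%:R) = \sum_(t < l) F (theta' + t%:R / l%:R).
Proof.
move=> l0 per; have lR : 0 < l%:R :> R by rewrite ltr0n.
pose z := Num.floor (theta * l%:R).
have z1 : z%:~R <= theta * l%:R by exact: floor_le.
have z2 : theta * l%:R < z%:~R + 1 by have := floorD1_gt (theta * l%:R); rewrite intrD.
exists (theta - z%:~R / l%:R); split.
  rewrite subr_ge0 ler_pdivrMr // z1 /= lerBlDr -[X in X + _]mul1r -mulrDl.
  by rewrite ler_pdivlMr // addrC ltW.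
have lz : (l%:Z != 0) by rewrite eqz_nat -lt0n.
have tl (t : 'I_l) : (`|((t%:Z + z) %% l%:Z)%Z| < l)%N.
  by rewrite -ltz_nat gez0_abs ?modz_ge0 //; exact: ltz_pmod.
pose s (t : 'I_l) := Ordinal (tl t).
have s_inj : injective s.
  move=> i j /(congr1 val) /= /(congr1 Posz); rewrite !gez0_abs ?modz_ge0 // => E.
  have : (i%:Z == j%:Z %[mod l%:Z])%Z by rewrite -(eqz_modDr z); apply/eqP.
  by rewrite !modz_nat !modn_small // eqz_nat => /eqP /val_inj.
rewrite [RHS](reindex_inj s_inj) /=; apply: eq_bigr => t _.
rewrite -[LHS](per (- ((t%:Z + z) %/ l%:Z)%Z)); congr F.
have -> : (`|((t%:Z + z) %% l%:Z)%Z|%N)%:R = ((t%:Z + z) %% l%:Z)%Z%:~R :> R.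
  by rewrite pmulrn gez0_abs ?modz_ge0.
have : (t%:R + z%:~R = ((t%:Z + z) %/ l%:Z)%Z%:~R * l%:R + ((t%:Z + z) %% l%:Z)%Z%:~R :> R).
  have /(congr1 (fun z : int => z%:~R : R)) := divz_eq (t%:Z + z) l%:Z.
  by rewrite !rmorphD /= rmorphM /= -!pmulrn.
rewrite mulrNz; set A := (_ %/ _)%Z%:~R; set C := (_ %% _)%Z%:~R => E.
have -> : C = t%:R + z%:~R - A * l%:R by rewrite E; ring.
by field; rewrite gt_eqF.
Qed.

Lemma continuous_integrable_itvco (R : realType) (F : R -> R) (a b : R) :
  continuous F -> (@lebesgue_measure R).-integrable `[a, b[ (EFin \o F).
Proof.
move=> cF.
have I : (@lebesgue_measure R).-integrable `[a, b] (EFin \o F).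
  apply: continuous_compact_integrable; first exact: segment_compact.
  exact: continuous_subspaceT.
by apply: integrableS I => //; apply: subset_itvl; rewrite bnd_simp.
Qed.

Lemma ler_dist_Rintegral_cst (R : realType) (F : R -> R) (a b c eta : R) :
  continuous F -> a <= b -> (forall v, a <= v <= b -> `|c - F v| <= eta) ->
  `|c * (b - a) - \int[@lebesgue_measure R]_(x in `[a, b[) F x| <= eta * (b - a).
Proof.
move=> cF ab h.
have iF : (@lebesgue_measure R).-integrable `[a, b[ (EFin \o F).
  exact: continuous_integrable_itvco.
have mI : fine (lebesgue_measure `[a, b[) = b - a.
  rewrite lebesgue_measure_itv /= lte_fin; case: ltP => //= ba.
  by apply/eqP; rewrite eq_sym subr_eq0; apply/eqP/le_anti; rewrite ab ba.
have ic k : (@lebesgue_measure R).-integrable `[a, b[ (EFin \o (fun=> k)).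
  by apply: continuous_integrable_itvco => x; exact: cvg_cst.
have up : \int[@lebesgue_measure R]_(x in `[a, b[) F x <= (c + eta) * (b - a).
  rewrite -mI -(@Rintegral_cst _ _ _ (@lebesgue_measure R)) //; apply: le_Rintegral => // x /=.
  rewrite in_itv /= => /andP [xa xb]; have := h x; rewrite xa (ltW xb) => /(_ isT).
  by rewrite ler_norml => /andP []; lra.
have lo : (c - eta) * (b - a) <= \int[@lebesgue_measure R]_(x in `[a, b[) F x.
  rewrite -mI -(@Rintegral_cst _ _ _ (@lebesgue_measure R)) //; apply: le_Rintegral => // x /=.
  rewrite in_itv /= => /andP [xa xb]; have := h x; rewrite xa (ltW xb) => /(_ isT).
  by rewrite ler_norml => /andP []; lra.
clear iF mI ic h cF.
move: up lo; set I := Rintegral _ _ _; move: I => I up lo.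
by rewrite ler_norml; apply/andP; split; lra.
Qed.

(** A single threshold [e] controls both errors, the mesh [1 / l <= 1 / e] and the height error
    [C / e]. Uniformity in [theta] is essential, since the phase left by the matrices is not under
    control. *)
Lemma riemann_sum_uniform (R : realType) (f : R * R -> R) (Y eta C : R) :
  {within @upper_half R, continuous f} ->
  (forall (z : int) x y, 0 < y -> f (x + z%:~R, y) = f (x, y)) ->
  0 < Y -> 0 < eta -> 0 <= C ->
  \forall e \near \oo, forall (theta h : R) (l : nat), (e <= l)%N -> 0 < h ->
    `|h - Y| <= C / e%:R ->
    `|l%:R^-1 * \sum_(t < l) f (theta + t%:R / l%:R, h) - mu_int Y f| <= eta.
Proof.
move=> cf per Y0 eta0 C0.
have [delta delta0 unif] := unif_continuous_horizontal R f Y eta cf Y0 eta0.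
have cF : continuous (fun t => f (t, Y)).
  move=> t; have ct : continuous (fun t : R => (t, Y)).
    move=> u; exact: (@cvg_pair R R R (nbhs u) (nbhs u) (nbhs Y) _ _ _
      id (fun=> Y) cvg_id (cvg_cst Y)).
  have uhO := open_upper_half R.
  have cft : f @ ((t, Y) : R * R) --> f (t, Y).
    have := cf; rewrite continuous_open_subspace // => /(_ (t, Y)); apply.
    by rewrite inE.
  exact: (cvg_comp _ _ (ct t) cft).
near=> e => theta h l el h0 hY.
have e1 : (0 < e)%N by near: e; exact: nbhs_infty_gt.
have e2 : (C + 1) / delta <= e%:R by near: e; exact: nbhs_infty_ger.
have l0 : (0 < l)%N by apply: leq_trans e1 el.
have lR : 0 < l%:R :> R by rewrite ltr0n.
have eR : 0 < e%:R :> R by rewrite ltr0n.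
have elR : e%:R <= l%:R :> R by rewrite ler_nat.
rewrite ler_pdivrMr // in e2.
have dl : l%:R^-1 <= delta.
  rewrite -[X in X <= _]mul1r ler_pdivrMr // (le_trans _ (ler_wpM2l (ltW delta0) elR)) //.
  by rewrite mulrC; lra.
have dC : C / e%:R <= delta by rewrite ler_pdivrMr // mulrC; lra.
have [theta' [/andP [t1 t2] ->]] := sum_shift_mod R (fun x => f (x, h)) theta l l0
  (fun z x => per z x h h0).
pose F t := f (t, Y); pose g t := f (theta' + t%:R / l%:R, h).
have iF (a b : R) : (@lebesgue_measure R).-integrable `[a, b[ (EFin \o F).
  exact: continuous_integrable_itvco.
have part (k : nat) : (k <= l)%N ->
    `|l%:R^-1 * \sum_(t < k) g t - \int[@lebesgue_measure R]_(x in `[0, k%:R / l%:R[) F x|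
      <= eta * (k%:R / l%:R).
  elim: k => [|k IH] kl.
    by rewrite big_ord0 mulr0 !mul0r set_itvco0 Rintegral_set0 subr0 normr0 mulr0.
  have kl' : k%:R / l%:R <= k.+1%:R / l%:R :> R by rewrite ler_pM2r ?invr_gt0 // ler_nat.
  have k0 : 0 <= k%:R / l%:R :> R by rewrite divr_ge0.
  have k1 : k.+1%:R / l%:R <= 1 :> R by rewrite ler_pdivrMr // mul1r ler_nat.
  have kS : k.+1%:R / l%:R - k%:R / l%:R = l%:R^-1 :> R.
    by rewrite -mulrBl -natr1 addrAC subrr add0r mul1r.
  have step : `|g k * (k.+1%:R / l%:R - k%:R / l%:R) -
     \int[@lebesgue_measure R]_(x in `[k%:R / l%:R, k.+1%:R / l%:R[) F x| <=
     eta * (k.+1%:R / l%:R - k%:R / l%:R).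
    apply: ler_dist_Rintegral_cst => // v /andP [v1 v2].
    apply: unif; [|rewrite ler_norml|apply: le_trans hY dC].
      by apply/andP; split; lra.
    by apply/andP; split; lra.
  have split_itv : `[0, k.+1%:R / l%:R[%classic =
      `[0, k%:R / l%:R[%classic `|` `[k%:R / l%:R, k.+1%:R / l%:R[%classic :> set R.
    by apply: itv_bndbnd_setU; rewrite bnd_simp.
  rewrite split_itv Rintegral_setU //=; first last.
  - apply/disj_setPS => y [/=]; rewrite 2!in_itv/= => /andP[_ yx] /andP[].
    by rewrite leNgt yx.
  - by rewrite -split_itv.
  rewrite big_ord_recr /= mulrDr.
  have := ler_normD (l%:R^-1 * \sum_(t < k) g t -
     \int[@lebesgue_measure R]_(x in `[0, k%:R / l%:R[) F x)
    (g k * (k.+1%:R / l%:R - k%:R / l%:R) -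
     \int[@lebesgue_measure R]_(x in `[k%:R / l%:R, k.+1%:R / l%:R[) F x).
  have := IH (ltnW kl); move: step; rewrite kS (mulrC (g k)) => step IHk.
  rewrite [X in _ -> _ <= eta * X](_ : _ = k%:R / l%:R + l%:R^-1); last by rewrite -kS; ring.
  rewrite (_ : forall a b c d : R, a + b - (c + d) = a - c + (b - d)); last by move=> *; ring.
  by move=> /le_trans; apply; rewrite mulrDr lerD.
have := part l (leqnn l); rewrite divff ?gt_eqF // mulr1.
by [].
Unshelve. all: by end_near.
Qed.

(** In the variables [rho = r / K] and [sg = s / h] the height is [Y / w] with
    [w = rho ^ 2 (1 + sg ^ 2)]. For [ep = 1 / e <= 1] one has [1 <= w <= (1 + 3 ep) (1 + ep) <= 1 +
    7 ep], which gives the constant 7. *)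
Lemma dist_cusp_height_le (R : realType) (Y n K r e s : R) :
  0 < Y -> 0 < n -> 0 < K -> 1 <= e -> K <= r -> e * r <= (e + 1) * K ->
  let h := (Y * (n * K) ^+ 2)^-1 in
  `|s| <= h / e -> `|h / ((n * r) ^+ 2 * (s ^+ 2 + h ^+ 2)) - Y| <= 7 * Y / e.
Proof.
move=> Y0 n0 K0 e1 Kr er h hs.
have e0 : 0 < e by lra.
have h0 : 0 < h by rewrite invr_gt0 mulr_gt0 ?exprn_gt0 // mulr_gt0.
have r0 : 0 < r by apply: lt_le_trans K0 Kr.
pose rho := r / K; pose sg := s / h; pose ep := e^-1.
have ep0 : 0 < ep by rewrite invr_gt0.
have ep1 : ep <= 1 by rewrite invf_le1.
have rho1 : 1 <= rho by rewrite ler_pdivlMr // mul1r.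
have rho2 : rho <= 1 + ep.
  rewrite ler_pdivrMr // -(ler_pM2l e0) /ep.
  by rewrite (_ : e * ((1 + e^-1) * K) = (e + 1) * K) //; field; rewrite gt_eqF.
have sg2 : sg ^+ 2 <= ep ^+ 2.
  rewrite -[leLHS]real_normK ?num_real // lerXn2r ?nnegrE ?normr_ge0 ?(ltW ep0) //.
  by rewrite /sg normrM normfV (gtr0_norm h0) ler_pdivrMr // mulrC.
pose w := rho ^+ 2 * (1 + sg ^+ 2).
have sg0 : 0 <= sg ^+ 2 by exact: sqr_ge0.
have rho3 : 1 <= rho ^+ 2 by rewrite expr_ge1 //; lra.
have w1 : 1 <= w by rewrite /w mulr_ege1 //; lra.
have w2 : w <= 1 + 7 * ep.
  have r3 : rho ^+ 2 <= 1 + 3 * ep by rewrite expr2; nra.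
  have s3 : 1 + sg ^+ 2 <= 1 + ep by rewrite expr2 in sg2; nra.
  apply: le_trans (_ : (1 + 3 * ep) * (1 + ep) <= _); last by nra.
  by rewrite ler_pM //; lra.
have E : h / ((n * r) ^+ 2 * (s ^+ 2 + h ^+ 2)) = Y / w.
  have sE : s = sg * h by rewrite /sg divfK // gt_eqF.
  have rE : r = rho * K by rewrite /rho divfK // gt_eqF.
  have hE : h ^-1 = Y * (n * K) ^+ 2 by rewrite /h invrK.
  have -> : (n * r) ^+ 2 * (s ^+ 2 + h ^+ 2) = (n * K) ^+ 2 * h ^+ 2 * w.
    by rewrite sE rE /w; ring.
  have -> : h / ((n * K) ^+ 2 * h ^+ 2 * w) = h^-1 / ((n * K) ^+ 2 * w).
    by field; rewrite !gt_eqF //; lra.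
  rewrite hE; field; rewrite !gt_eqF //; lra.
have w0 : 0 < w by lra.
rewrite E distrC ger0_norm; last first.
  by rewrite subr_ge0 ler_pdivrMr // ler_peMr // ltW.
have -> : Y - Y / w = Y * (w - 1) / w by field; rewrite gt_eqF.
rewrite ler_pdivrMr // (_ : 7 * Y / e = Y * (7 * ep)); last by rewrite /ep; ring.
apply: le_trans (_ : Y * (7 * ep) * 1 <= _); last first.
  by apply: ler_wpM2l => //; rewrite mulr_ge0 ?ltW // mulr_gt0.
by rewrite mulr1 ler_wpM2l ?(ltW Y0) //; lra.
Qed.

Lemma sum_ord_mul (V : nmodType) (m l : nat) (F : nat -> V) :
  \sum_(j < m * l) F j = \sum_(j < m) \sum_(k < l) F (j + m * k)%N.
Proof.
rewrite exchange_big /=; elim: l => [|l IH].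
  by rewrite muln0 !big_ord0.
rewrite [RHS]big_ord_recr /= -IH mulnS addnC -!(big_mkord predT) /=.
rewrite (@big_cat_nat _ _ _ (m * l)) ?leq_addr //=; congr (_ + _).
rewrite -{1}[(m * l)%N]add0n big_addn addKn !big_mkord.
by apply: eq_bigr.
Qed.

(** The gcd [d] of [p + j r] and [m] divides the whole progression [p + j r + m r k]. Cancelling it
    turns the class of [j] into the cusps [(a0 + D k) / (D l)] with [D = (m / d) r], and the
    denominator reduced by [d] multiplies the height by [d ^ 2]. *)
Lemma sum_class_near_mu (R : realType) (m : nat) (Y eta M C : R) (f : R * R -> R) :
  (0 < m)%N -> 0 < Y -> 0 <= C ->
  SL2Z_invariant f -> {within @upper_half R, continuous f} ->
  (forall p, p \in @upper_half R -> `|f p| <= M) -> 0 < eta ->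
  \forall e \near \oo, forall (l r p j : nat) (s h : R),
    prime l -> coprime r (m * l) -> coprime l m -> coprime p (m * l * r) ->
    (0 < r)%N -> (e <= l)%N -> 0 < h ->
    `|h / ((m * l * r)%:R ^+ 2 * (s ^+ 2 + h ^+ 2)) - Y| <= C / e%:R ->
    `|l%:R^-1 * \sum_(k < l) f (p%:R / (m * l * r)%:R + s + (j + m * k)%:R / (m * l)%:R, h)
      - mu_int ((gcdn (p + j * r) m ^ 2)%:R * Y) f| <= eta.
Proof.
move=> m0 Y0 C0 inv cf fM eta0.
have M0 : 0 <= M by apply: le_trans (fM (0, 1) _) => //; rewrite inE /upper_half /=.
near=> e => l r p j s h pl crml clm cp r0 el h0 hC.
have e1 : (0 < e)%N by near: e; exact: nbhs_infty_gt.
(* The unmatched cusps cost [4 M / l], hence at most [eta / 2]. *)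
have eM : 8 * M / eta <= e%:R by near: e; exact: nbhs_infty_ger.
(* One [e] for all the possible gcds [d <= m]; [d = 0] is vacuous. *)
have RS : forall d : 'I_m.+1, (0 < d)%N ->
  forall (theta h : R) (l : nat), (e <= l)%N -> 0 < h ->
    `|h - (d ^ 2)%:R * Y| <= m%:R ^+ 2 * C / e%:R ->
    `|l%:R^-1 * \sum_(t < l) f (theta + t%:R / l%:R, h) - mu_int ((d ^ 2)%:R * Y) f| <= eta / 2.
  near: e; apply: filter_forall => d; have [->|d0] := posnP d.
    by apply: nearW.
  have H := riemann_sum_uniform R f ((d ^ 2)%:R * Y) (eta / 2) (m%:R ^+ 2 * C) cf
    (fun z x y => invariant_translate R f inv z x y).
  have dY : 0 < (d ^ 2)%:R * Y by rewrite mulr_gt0 // ltr0n expn_gt0 d0.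
  have mC : 0 <= m%:R ^+ 2 * C by rewrite mulr_ge0 ?exprn_ge0.
  by apply: filterS (H dY (divr_gt0 eta0 (ltr0n R 2)) mC) => e He _.
have lR : 0 < l%:R :> R by rewrite ltr0n prime_gt0.
set d := gcdn _ m.
have d0 : (0 < d)%N by rewrite gcdn_gt0 m0 orbT.
have dm : (d %| m)%N by exact: dvdn_gcdr.
have dp : (d %| p + j * r)%N by exact: dvdn_gcdl.
pose a0 := ((p + j * r) %/ d)%N; pose D := (m %/ d * r)%N.
have aE : (p + j * r = d * a0)%N by rewrite [RHS]mulnC divnK.
have mE : (m = d * (m %/ d))%N by rewrite [RHS]mulnC divnK.
have md0 : (0 < m %/ d)%N by rewrite divn_gt0 // dvdn_leq.
have D0 : (0 < D)%N by rewrite muln_gt0 md0.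
have crl : coprime r l by move: crml; rewrite coprimeMr => /andP [].
have cpr : coprime p r by move: cp; rewrite coprimeMr => /andP [].
have cDl : coprime D l.
  rewrite coprimeMl crl andbT; apply: coprime_dvdl (_ : coprime m l); first by rewrite dvdn_div.
  by rewrite coprime_sym.
(* Against [m / d] because [d] is the full gcd with [m]; against [r] because [p + j r] is [p] modulo
   [r]. *)
have caD : coprime a0 D.
  rewrite coprimeMr; apply/andP; split.
    by rewrite /coprime -(eqn_pmul2l d0) muln_gcdr -aE -mE muln1.
  apply: coprime_dvdl (_ : coprime (p + j * r) r); first by rewrite dvdn_div.
  by rewrite coprime_sym /coprime addnC gcdnMDl -/(coprime _ _) coprime_sym.
have [theta Hth] := sum_translates_at_cusps R f M a0 D l s h inv fM pl cDl caD D0 h0.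
have dR : d%:R != 0 :> R by rewrite pnatr_eq0 -lt0n.
have DR : D%:R != 0 :> R by rewrite pnatr_eq0 -lt0n.
have rR : r%:R != 0 :> R by rewrite pnatr_eq0 -lt0n.
have mdR : (m %/ d)%:R != 0 :> R by rewrite pnatr_eq0 -lt0n.
have lR' : l%:R != 0 :> R by rewrite gt_eqF.
have E1 (k : nat) : p%:R / (m * l * r)%:R + s + (j + m * k)%:R / (m * l)%:R =
   (a0 + D * k)%:R / (D * l)%:R + s.
  have pE : p%:R = d%:R * a0%:R - j%:R * r%:R :> R by rewrite -!natrM -aE natrD addrK.
  rewrite pE mE /D !(natrM, natrD); field; by rewrite dR rR mdR lR'.
have E2 : h / ((D * l)%:R ^+ 2 * (s ^+ 2 + h ^+ 2)) =
    (d ^ 2)%:R * (h / ((m * l * r)%:R ^+ 2 * (s ^+ 2 + h ^+ 2))).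
  have sh0 : s ^+ 2 + h ^+ 2 != 0 by rewrite gt_eqF // ltr_wpDl ?sqr_ge0 // exprn_gt0.
  rewrite [in RHS]mE /D !(natrM, natrX); field; by rewrite dR rR mdR lR' sh0.
under eq_bigr do rewrite E1.
rewrite E2 in Hth.
set h' := (d ^ 2)%:R * _ in Hth.
have q0 : 0 < (m * l * r)%:R :> R by rewrite ltr0n !muln_gt0 m0 prime_gt0.
have sh0 : 0 < s ^+ 2 + h ^+ 2 by rewrite ltr_wpDl ?sqr_ge0 // exprn_gt0.
have h'0 : 0 < h'.
  rewrite /h' mulr_gt0 ?ltr0n ?expn_gt0 ?d0 //.
  by rewrite divr_gt0 // mulr_gt0 // exprn_gt0.
have dlem : (d < m.+1)%N by rewrite ltnS dvdn_leq.
have h'C : `|h' - (d ^ 2)%:R * Y| <= m%:R ^+ 2 * C / e%:R.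
  rewrite -mulrBr normrM ger0_norm // -[leRHS]mulrA ler_pM //.
  by rewrite -natrX ler_nat leq_sqr -ltnS.
have := RS (Ordinal dlem) d0 theta h' l el h'0 h'C.
move: Hth; set S1 := \sum_(k < l) _; set S2 := \sum_(t < l) _ => S12 S2mu.
have -> : l%:R^-1 * S1 - mu_int ((d ^ 2)%:R * Y) f =
   l%:R^-1 * (S1 - S2) + (l%:R^-1 * S2 - mu_int ((d ^ 2)%:R * Y) f) by ring.
apply: le_trans (ler_normD _ _) _; rewrite (splitr eta) lerD //.
rewrite normrM ger0_norm ?invr_ge0 ?(ltW lR) // mulrC ler_pdivrMr //.
apply: le_trans S12 _.
have : 8 * M <= eta * l%:R.
  by rewrite ler_pdivrMr // in eM; apply: le_trans eM _; rewrite mulrC ler_pM2l // ler_nat.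
by lra.
Unshelve. all: by end_near.
Qed.

(** * Choice of the heights *)

(** The [m] classes have equal weight, and each average is within [eta] of the integral over its own
    horocycle. The threshold on [e] does not depend on [l], [B] or [x]. *)
Lemma delta_int_near_nu (R : realType) (m : nat) (Y eta : R) (f : R * R -> R) :
  (0 < m)%N -> 0 < Y -> test_fun f -> 0 < eta ->
  \forall e \near \oo, forall (l B : nat) (x : R),
    prime l -> ~~ (l %| m)%N -> (e <= l)%N -> (0 < B)%N ->
    rational_balls m l e B (sample_height m Y l B / e%:R) x ->
    `|delta_int (m * l) x (sample_height m Y l B) f - nu_int m Y f| <= eta.
Proof.
move=> m0 Y0 [inv cf [M fM]] eta0.
have C0 : 0 <= 7 * Y by rewrite mulr_ge0 // ltW.
near=> e => l B x pl lm el B0 [r [p [r1 r2 crml cp [_ xs]]]].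
have e0 : (0 < e)%N by near: e; exact: nbhs_infty_gt.
have S : forall (l r p j : nat) (s h : R),
    prime l -> coprime r (m * l) -> coprime l m -> coprime p (m * l * r) ->
    (0 < r)%N -> (e <= l)%N -> 0 < h ->
    `|h / ((m * l * r)%:R ^+ 2 * (s ^+ 2 + h ^+ 2)) - Y| <= 7 * Y / e%:R ->
    `|l%:R^-1 * \sum_(k < l) f (p%:R / (m * l * r)%:R + s + (j + m * k)%:R / (m * l)%:R, h)
      - mu_int ((gcdn (p + j * r) m ^ 2)%:R * Y) f| <= eta.
  by near: e; exact: (sum_class_near_mu R m Y eta M).
have l0 := prime_gt0 pl.
have n0 : (0 < m * l)%N by rewrite muln_gt0 m0.
have K0 : (0 < 2 * m * B)%N by rewrite !muln_gt0 m0.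
have r0 : (0 < r)%N by apply: leq_trans K0 r1.
set h := sample_height m Y l B in xs *.
have h0 : 0 < h by rewrite invr_gt0 mulr_gt0 // exprn_gt0 // mulr_gt0 // ltr0n.
have clm : coprime l m by rewrite prime_coprime.
pose s := x - p%:R / (m * l * r)%:R.
have hY : `|h / ((m * l * r)%:R ^+ 2 * (s ^+ 2 + h ^+ 2)) - Y| <= 7 * Y / e%:R.
  rewrite [(m * l * r)%:R]natrM.
  apply: (dist_cusp_height_le R Y (m * l)%:R (2 * m * B)%:R r%:R e%:R s) => //.
  - by rewrite ltr0n.
  - by rewrite ltr0n.
  - by rewrite ler1n.
  - by rewrite ler_nat.
  - by rewrite natr1 -!natrM ler_nat.
have part (j : 'I_m) := S l r p j s h pl crml clm cp r0 el h0 hY.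
have xE : p%:R / (m * l * r)%:R + s = x by rewrite /s; ring.
have crm : coprime r m by move: crml; rewrite coprimeMr => /andP [].
have -> : nu_int m Y f = m%:R^-1 * \sum_(j < m) mu_int ((gcdn (p + j * r) m ^ 2)%:R * Y) f.
  rewrite /nu_int; congr (_ * _).
  rewrite (sum_gcd_progression _ (fun d => mu_int ((d ^ 2)%:R * Y) f) m p r m0 crm).
  by apply: eq_bigr => d _; rewrite mulr_natl.
have -> : delta_int (m * l) x h f = m%:R^-1 *
    \sum_(j < m) l%:R^-1 * \sum_(k < l) f (x + (j + m * k)%:R / (m * l)%:R, h).
  rewrite /delta_int (sum_ord_mul _ m l (fun j => f (x + j%:R / (m * l)%:R, h))).
  by rewrite -mulr_sumr mulrA natrM invfM.
rewrite -mulrBr -sumrB normrM ger0_norm ?invr_ge0 // mulrC ler_pdivrMr ?ltr0n //.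
apply: le_trans (ler_norm_sum _ _ _) _.
apply: le_trans (_ : \sum_(j < m) eta <= _); last by rewrite sumr_const card_ord mulr_natr.
by apply: ler_sum => j _; have := part j; rewrite xE.
Unshelve. all: by end_near.
Qed.

(** The product [u l * (1 + kappa * S l)], with [S] the partial sum of inverse primes, does not
    increase: [(1 - kappa x) v <= v - kappa x] for [v >= 1]. This linear form stands in for an
    infinite product, and the divergence of [S] drives [u] to 0. *)
Lemma decrease_by_primes (R : archiRealFieldType) (u : nat -> R) (kappa : R) (N : nat) :
  0 < kappa -> (forall l, 0 <= u l) -> (forall l, (N <= l)%N -> u l.+1 <= u l) ->
  (forall l, (N <= l)%N -> prime l -> u l.+1 <= (1 - kappa / l%:R) * u l) ->
  forall eta, 0 < eta -> exists l, u l <= eta.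
Proof.
move=> k0 u0 dec decp eta eta0.
pose S l := \sum_(N <= p < l | prime p) (p%:R^-1 : R).
have S0 l : 0 <= S l by apply: sumr_ge0 => p _; rewrite invr_ge0.
have key l : u (N + l)%N * (1 + kappa * S (N + l)%N) <= u N.
  elim: l => [|l IH].
    by rewrite addn0 /S big_geq // mulr0 addr0 mulr1.
  have Nl : (N <= N + l)%N by rewrite leq_addr.
  have SS : S (N + l).+1 = S (N + l)%N + (if prime (N + l) then (N + l)%:R^-1 else 0).
    by rewrite /S big_mkcond big_nat_recr //= -big_mkcond.
  have kS : 0 <= 1 + kappa * S (N + l)%N by rewrite addr_ge0 // mulr_ge0 // ltW.
  rewrite addnS SS; apply: le_trans IH; case: ifP => pl; last first.
    by rewrite addr0 ler_wpM2r // dec.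
  set x := (N + l)%:R^-1; set v := 1 + kappa * (S (N + l)%N + x).
  have x0 : 0 <= kappa * x by rewrite mulr_ge0 ?invr_ge0 // ltW.
  have v0 : 0 <= v by rewrite addr_ge0 // mulr_ge0 ?(ltW k0) // addr_ge0 // invr_ge0.
  apply: le_trans (ler_wpM2r v0 (decp _ Nl pl)) _.
  rewrite -/x mulrAC mulrC ler_wpM2l // /v.
  have := mulr_ge0 x0 x0; have := mulr_ge0 x0 (mulr_ge0 (ltW k0) (S0 (N + l)%N)).
  by lra.
have [N' [NN' h]] := sum_inv_primes_diverges R (u N / (eta * kappa)) N.
exists N'; have := key (N' - N)%N; rewrite subnKC // -/(S N') in h *.
move=> kk; rewrite leNgt; apply/negP => lt.
have kS : 0 < 1 + kappa * S N' by rewrite ltr_wpDr // mulr_ge0 // ltW.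
have : u N <= S N' * (eta * kappa) by rewrite -ler_pdivrMr // mulr_gt0.
by rewrite -(ltr_pM2r kS) in lt; lra.
Qed.

Lemma sample_height_near (R : realType) (m l : nat) (Y c : R) :
  (0 < m)%N -> (0 < l)%N -> 0 < Y -> 0 < c ->
  \forall B \near \oo, sample_height m Y l B < c.
Proof.
move=> m0 l0 Y0 c0; near=> B.
have B0 : (0 < B)%N by near: B; exact: nbhs_infty_gt.
have Bc : (Y * c)^-1 < B%:R by near: B; exact: nbhs_infty_gtr.
have BR : 1 <= B%:R :> R by rewrite ler1n.
have N1 : B%:R <= (m * l)%:R * (2 * m * B)%:R :> R.
  rewrite -natrM ler_nat; apply: leq_trans (leq_pmull _ _); last by rewrite muln_gt0 m0.
  by rewrite leq_pmull // muln_gt0.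
have N2 : B%:R <= ((m * l)%:R * (2 * m * B)%:R) ^+ 2 :> R.
  have N1' := le_trans BR N1; apply: le_trans N1 _; rewrite expr2.
  by apply: ler_peMl; rewrite ?mulr_ge0.
have YB : 0 < Y * B%:R by rewrite mulr_gt0 // ltr0n.
have N0 := lt_le_trans (lt_le_trans ltr01 BR) N2.
have h1 : sample_height m Y l B <= (Y * B%:R)^-1.
  rewrite /sample_height lef_pV2; [by rewrite ler_pM2l|rewrite posrE..] => //.
  by rewrite mulr_gt0.
apply: le_lt_trans h1 _; rewrite -[ltLHS]div1r ltr_pdivrMr //.
have : Y * c * (Y * c)^-1 < Y * c * B%:R by rewrite ltr_pM2l // mulr_gt0.
by rewrite divff ?gt_eqF ?mulr_gt0 //; lra.
Unshelve. all: by end_near.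
Qed.

(* The heights are chosen one prime at a time: [B l] is taken so large that the
   balls at stage [l] remove from every surviving open set [U k], [k <= l], a
   proportion at least [c k / (2 l)] of its measure; the sum of these
   proportions over the primes diverges. *)
Lemma exists_heights_full_limsup (R : realType) (m : nat) (Y : R) (y : nat -> R) :
  (0 < m)%N -> 0 < Y -> (forall l, prime l -> ~~ (l %| m)%N -> 0 < y l) ->
  exists B : nat -> nat,
    (forall l, prime l -> ~~ (l %| m)%N -> (0 < B l)%N /\ sample_height m Y l (B l) < y l) /\
    (forall k : nat, exists E : set R, [/\ measurable E, (@lebesgue_measure R) E = 0%E &
      forall x, 0 < x < 1 -> ~ E x -> exists l,
        [/\ prime l, ~~ (l %| m)%N, (k < l)%N &
            rational_balls m l k.+1 (B l) (sample_height m Y l (B l) / k.+1%:R) x]]).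
Proof.
move=> m0 Y0 yP; set mu := @lebesgue_measure R.
have /choice [c /choice [l0 cP]] := fun k => measure_rational_balls_near R m k.+1 Y m0 isT Y0.
pose A k l B := rational_balls m l k.+1 B (sample_height m Y l B / k.+1%:R) : set R.
have mA k l B : measurable (A k l B).
  by apply: measurable_realfun.closed_measurable; exact: closed_rational_balls.
pose cond k l := [&& prime l, ~~ (l %| m)%N, (l0 k <= l)%N & (k < l)%N].
pose good (U : nat -> set R) := forall k, open (U k) /\ U k `<=` `]0, 1[%classic.
(* The parameter [B] is chosen as a function of the stage and of an arbitrary family of surviving
   sets, so that the recursion for [U] can feed its own values to it. The premises inside [Q] make
   the choice total. *)
pose Q (lU : nat * (nat -> set R)) (B : nat) := let l := lU.1 in let U := lU.2 in
  prime l -> ~~ (l %| m)%N -> good U ->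
  [/\ (0 < B)%N, sample_height m Y l B < y l &
    forall k, cond k l -> (mu (U k `\` A k l B) <=
      (1 - c k / l%:R / 2)%:E * mu (U k))%E].
have exQ lU : exists B, Q lU B.
  case: lU => l U; rewrite /Q /=.
  have [pl|] := boolP (prime l); last by exists 0%N.
  have [//|lm] := boolP (l %| m)%N; first by exists 0%N.
  have [gU|] := pselect (good U); last by exists 0%N.
  have l1 := prime_gt0 pl.
  have near1 := sample_height_near R m l Y (y l) m0 l1 Y0 (yP l pl lm).
  have near2 : \forall B \near \oo, forall k : 'I_l, cond k l ->
      (mu (U k `\` A k l B) <= (1 - c k / l%:R / 2)%:E * mu (U k))%E.
    apply: filter_forall => k; have [/and4P [_ _ lk _]|] := boolP (cond k l); last first.
      by move=> _; apply: nearW.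
    have [ck0 Hk] := cP k; have [oU U01] := gU k.
    have U01' : U k `<=` `[0, 1[%classic.
      by move=> x /U01 /=; rewrite !in_itv /= => /andP [/ltW -> ->].
    have ck : 0 <= c k / l%:R by rewrite divr_ge0 // ltW.
    have := measure_setD_open_near R (A k l) (c k / l%:R) (U k) ck (mA k l) (Hk l pl lk) oU U01'.
    by apply: filterS => B HB _.
  have [B [[B0 B1] B2]] := @filter_ex _ _ _ _
    (filterI (filterI (nbhs_infty_gt 0) near1) near2).
  exists B => _ _ _; split => // k ck.
  have kl : (k < l)%N by case/and4P: ck.
  exact: (B2 (Ordinal kl)).
have [Bf BfP] := choice exQ.
pose U := fix U l : nat -> set R := if l is l'.+1 then
    (fun k => if cond k l' then U l' k `\` A k l' (Bf (l', U l')) else U l' k)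
  else fun=> `]0, 1[%classic.
have US l k : U l.+1 k = if cond k l then U l k `\` A k l (Bf (l, U l)) else U l k by [].
have gU l : good (U l).
  elim: l => [|l IH] k.
    by split => //; exact: interval_open.
  have [oU U01] := IH k; rewrite US; case: ifP => _ //; split.
    by rewrite setDE; apply: openI => //; apply: closed_openC; exact: closed_rational_balls.
  by move=> x [/U01].
exists (fun l => Bf (l, U l)); split.
  by move=> l pl lm; have [] := BfP (l, U l) pl lm (gU l).
(* [E] consists of the points never caught at precision [1 / (k + 1)]. *)
move=> k; pose E := \bigcap_l U l k.
have mU l : measurable (U l k) by apply: measurable_realfun.open_measurable; exact: (gU l k).1.
have mE : measurable E by exact: bigcapT_measurable.
have leM (S T : set R) : measurable S -> measurable T -> S `<=` T -> (mu S <= mu T)%E.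
  by move=> mS mT ST; apply: le_measure; rewrite ?inE.
have muU l : mu (U l k) \is a fin_num.
  rewrite ge0_fin_numE //; apply: (@le_lt_trans _ _ (mu `]0%R, 1%R[%classic)).
    by apply: leM; [exact: mU|exact: measurable_itv|exact: (gU l k).2].
  by rewrite /mu lebesgue_measure_itv /= lte_fin ltr01 -EFinD ltry.
have [ck0 _] := cP k.
pose u l := fine (mu (U l k)).
have uE l : mu (U l k) = (u l)%:E by rewrite fineK.
have dec l : u l.+1 <= u l.
  rewrite -lee_fin -!uE; apply: leM; [exact: mU|exact: mU|].
  by rewrite US; case: ifP => _ // x [].
pose N := maxn m.+1 (maxn (l0 k) k.+1).
have small eta : 0 < eta -> exists l, u l <= eta.
  apply: (decrease_by_primes R u (c k / 2) N) => //.
  - by rewrite divr_gt0.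
  - by move=> l; exact: fine_ge0.
  - move=> l; rewrite !geq_max => /and3P [ml lk kl] pl.
    have lm : ~~ (l %| m)%N by apply/negP => /(dvdn_leq m0); rewrite leqNgt ml.
    have cl : cond k l by rewrite /cond pl lm lk kl.
    have [_ _ /(_ k cl)] := BfP (l, U l) pl lm (gU l).
    have E1 : U l k `\` A k l (Bf (l, U l)) = U l.+1 k by rewrite US cl.
    by rewrite [(l, U l).1]/= [(l, U l).2]/= E1 !uE -EFinM lee_fin mulrAC.
exists E; split => //.
  apply/eqP; rewrite -measure_le0; apply/lee_addgt0Pr => eta eta0; rewrite add0e.
  have [l ul] := small eta eta0.
  apply: (@le_trans _ _ (mu (U l k))); last by rewrite uE lee_fin.
  by apply: leM; [exact: mE|exact: mU|move=> x; exact].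
move=> x x01 nE.
have [l nUl] : exists l, ~ U l k x by apply/existsNP => h; apply: nE => l _; exact: h.
(* The first stage that loses [x] is the prime whose balls catch it. *)
elim: l nUl => [|l IH]; first by case; rewrite /= in_itv.
have [Ul|nUl] := pselect (U l k x); last by move=> _; exact: IH.
rewrite US; case: ifP => [cl nD|//]; exists l.
case/and4P: cl => pl lm _ kl; split => //.
by apply: contra_notP nD => nA; split.
Qed.

Theorem theorem1p7 (R : realType) (m : nat) (Y : R) :
  0 < Y -> 1 < (m ^ 2)%:R * Y ->
  forall c : nat -> R, (forall n, inPm m n -> 0 < c n) ->
  exists y : nat -> R,
    (forall n, inPm m n -> 0 < y n < c n) /\
    (@lebesgue_measure R).-negligible
      [set x : R | 0 <= x < 1 /\
         ~ (exists nk : nat -> nat,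
              [/\ (forall k, (nk k < nk k.+1)%N),
                  (forall k, inPm m (nk k)) &
                  weak_cvg_delta_nu nk x y m Y])].
Proof.
move=> Y0 mY c c0.
have m0 : (0 < m)%N by case: m mY {c0} => //; rewrite mul0r ltr10.
have cP l : prime l -> ~~ (l %| m)%N -> 0 < c (m * l)%N.
  by move=> pl lm; apply: c0; exists l.
have [B [B1 B2]] := exists_heights_full_limsup R m Y (fun l => c (m * l)%N) m0 Y0 cP.
(* For [n = m l] the quotient [n %/ m] recovers [l]. *)
pose y n := sample_height m Y (n %/ m) (B (n %/ m)%N).
have yE l : y (m * l)%N = sample_height m Y l (B l) by rewrite /y mulKn.
exists y; split.
  move=> n [l [pl lm ->]]; have [Bl0 yl] := B1 l pl lm; rewrite yE yl andbT.
  by rewrite invr_gt0 mulr_gt0 // exprn_gt0 // -natrM ltr0n !muln_gt0 m0 prime_gt0 //.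
have [E EP] := choice B2.
(* The point 0 joins the null set because the surviving sets start from the open interval. *)
apply: (@negligibleS _ _ _ (@lebesgue_measure R) ([set 0] `|` \bigcup_k E k)); last first.
  apply: negligibleU.
    by exists [set 0]; split; [exact: measurable_set1|exact: lebesgue_measure_set1|].
  apply: negligible_bigcup => k; have [mE E0 _] := EP k.
  by exists (E k); split.
move=> x [/andP [x0 x1] nnk]; rewrite /setU /=.
have [->|xn0] := eqVneq x 0; [by left|right].
have {x0}x0 : 0 < x by rewrite lt_neqAle eq_sym xn0.
apply: contra_notP nnk => nE.
have H k : exists l, [/\ prime l, ~~ (l %| m)%N, (k < l)%N &
    rational_balls m l k.+1 (B l) (sample_height m Y l (B l) / k.+1%:R) x].
  have [_ _] := EP k; apply; first by rewrite x0.
  by move=> Ek; apply: nE; exists k.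
have [lk lkP] := choice H.
(* Each prime found becomes the next precision index. As [lk k > k], the primes
   [lk (K i) = K (i + 1)] increase strictly, and the precision [1 / (K i + 1)] tends to 0 along the
   same subsequence. *)
pose K := fix K i : nat := if i is i'.+1 then lk (K i') else 0%N.
have Klk i : (K i < lk (K i))%N by have [] := lkP (K i).
have Ki i : (i <= K i)%N by elim: i => // i IH; apply: leq_ltn_trans IH (Klk i).
exists (fun i => (m * lk (K i))%N); split.
- by move=> i; rewrite ltn_pmul2l //=; exact: (Klk i.+1).
- by move=> i; have [pl lm _ _] := lkP (K i); exists (lk (K i)).
move=> f tf; apply/cvgrPdist_le => eta eta0.
have [e0 _ He] := delta_int_near_nu R m Y eta f m0 Y0 tf eta0.
exists e0 => // i /= ei; have [pl lm kl hx] := lkP (K i).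
rewrite yE distrC; apply: (He (K i).+1) => //=.
  by apply: leq_trans ei _; rewrite (leq_trans (Ki i)).
by have [] := B1 _ pl lm.
Qed.
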